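(* Let $k$ be an algebraically closed field of characteristic $0$ and $d\ge 1$. A general threefold of degree $d$ in $\mathbb P^4$ can be defined by a linear pfaffian if and only if $d\le 5$.
   Context: A hypersurface $X\subset\mathbb P^4$ of degree $d$ ''can be defined by a linear pfaffian'' if there is a skew-symmetric $(2d)\times(2d)$ matrix $M$ whose entries are linear forms in $k[X_0,\dots,X_4]$ such that $X$ is defined by the equation $\operatorname{pf}M=0$. ''A general threefold of degree $d$'' means a hypersurface corresponding to a point of some non-empty Zariski open subset of the projective space $|\mathcal O_{\mathbb P^4}(d)|$. *)

(* Defs.v *)
From mathcomp Require Export all_boot all_order all_fingroup all_algebra.
From mathcomp Require Export mpoly.

Set Implicit Arguments.
Unset Strict Implicit.
Unset Printing Implicit Defensive.

Import GRing.Theory.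
Local Open Scope ring_scope.

Lemma pf_fst_subproof n (i : 'I_n) : (i.*2 < 2 * n)%N.
Proof. by rewrite mul2n ltn_double. Qed.

Lemma pf_snd_subproof n (i : 'I_n) : (i.*2.+1 < 2 * n)%N.
Proof. by rewrite mul2n ltn_Sdouble. Qed.

Definition pf_fst n (i : 'I_n) : 'I_(2 * n) := Ordinal (pf_fst_subproof i).
Definition pf_snd n (i : 'I_n) : 'I_(2 * n) := Ordinal (pf_snd_subproof i).

(* The permutations s satisfying pf_matching are in bijection with the perfect
   matchings { {s 0, s 1}, {s 2, s 3}, ... } of {0, ..., 2n-1}: each pair is
   listed in increasing order, and the pairs are listed by increasing first
   element. *)
Definition pf_matching n (s : 'S_(2 * n)) : bool :=
  [forall i : 'I_n, s (pf_fst i) < s (pf_snd i)]%N &&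
  [forall i : 'I_n, forall j : 'I_n,
     (i < j)%N ==> (s (pf_fst i) < s (pf_fst j))%N].

Definition pfaffian (R : comNzRingType) n (A : 'M[R]_(2 * n)) : R :=
  \sum_(s : 'S_(2 * n) | pf_matching s)
    (-1) ^+ s * \prod_(i < n) A (s (pf_fst i)) (s (pf_snd i)).

Definition form_monom n d := {m : 'X_{1..n < d.+1} | mdeg m == d}.

(* The homogeneous coordinates of a form on the projective space of degree d
   hypersurfaces. *)
Definition form_coef (k : fieldType) n d (F : dhomog n k d) :
    'I_#|{: form_monom n d}| -> k :=
  fun i => (F : {mpoly k[n]})@_(val (val (enum_val i))).

(* A degree d hypersurface in P^(n-1), i.e. a point of the projective space
   |O(d)|, is given by a nonzero form, two forms giving the same point iff they
   are proportional.  A subset of |O(d)| is represented by the set of all its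
   representatives; an open set is the complement of the common zero locus of
   a family S of homogeneous polynomials in the coefficients (hence it is
   automatically stable under scaling). *)
Definition zariski_open_forms (k : fieldType) n d
    (U : dhomog n k d -> Prop) : Prop :=
  exists S : {mpoly k[#|{: form_monom n d}|]} -> Prop,
    (forall P, S P -> exists e : nat, P \is e.-homog) /\
    (forall F, U F <-> F != 0 /\ exists2 P, S P & P.@[form_coef F] != 0).

Definition general_hypersurface (k : fieldType) n d
    (Q : dhomog n k d -> Prop) : Prop :=
  exists U : dhomog n k d -> Prop,
    [/\ zariski_open_forms U, exists F, U F & forall F, U F -> Q F].

(* pf M = 0 and F = 0 define the same hypersurface, i.e. the same point of
   |O(d)|, iff pf M is a nonzero scalar multiple of F. *)
Definition linear_pfaffian (k : fieldType) n d (F : dhomog n k d) : Prop :=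
  exists M : 'M[{mpoly k[n]}]_(2 * d),
    [/\ M^T = - M,
        forall i j, M i j \is 1.-homog
      & exists2 c : k, c != 0 & pfaffian M = c *: (F : {mpoly k[n]})].

(* Main.v *)
Require Import Defs.
From mathcomp Require Import closed_field ring zify ssrZ.
From Stdlib Require BinInt.

(** Both directions concern the polynomial map sending a skew matrix of linear forms
    in five variables, of size [2 * d], to the coefficients of its Pfaffian.

    For [d <= 5] the image contains a nonempty open set.  It suffices to find one
    matrix at which the differential of this map is surjective onto forms of degree
    [d]: the image then contains curves through one point with all velocities, so
    that no nonzero polynomial vanishes on it ([mpoly_curve]), and by quantifier
    elimination the image of a polynomial map over an algebraically closed field is
    either contained in a hypersurface or contains the complement of one
    ([image_generic]).  The differential at a matrix with integer coefficients is
    surjective if the polynomials obtained by changing one entry span all monomials,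
    which integer elimination verifies for one sparse matrix in each degree
    ([tables_span]).  As Pfaffians are computed there, the defining sum over perfect
    matchings is first turned into the recursive expansion along the first row
    ([pfaffian_pfl]).

    For [d >= 6] there are too few parameters, once congruences [P M P^T] by invertible
    constant matrices are taken into account: these multiply the Pfaffian by a scalar
    ([pfaffian_congr]).  Write [M = \sum_i X_i M_i] and let [T = M_1 M_0^-1], for
    generic [M_0] and [M_1].  The forms [M_0] and [M_1] vanish on each pair of vectors
    [u T^i], [u T^j], and in a basis formed of iterates of two vectors [u] and [v] they
    are given by a single Hankel sequence, in which a suitable [v] fixes all but [d]
    entries ([hankel_normal_form]).  Hence, up to scalars, the Pfaffians depend on [d]
    parameters for [M_0] and [M_1] and on [3 * 'C(2 * d, 2)] for the other three
    matrices.  Together with a scalar factor these are fewer than the ['C(d + 4, 4)]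
    coefficients of a form ([param_lt]), so that the coefficients satisfy an algebraic
    relation on this family ([mpoly_dependent]).  The relation extends to all matrices
    by joining an arbitrary one to a nondegenerate one by a line
    ([vanish_skew_linear]), and a general form does not satisfy it. *)

Set Implicit Arguments.
Unset Strict Implicit.
Unset Printing Implicit Defensive.

Import GRing.Theory.
Local Open Scope ring_scope.

(** * Alternating sums over a list and the list Pfaffian *)

Section ListPfaffian.
Variables (R : comNzRingType) (T : Type).

(** The alternating sum, over the positions of [l], of [g b r], where [b] is the
    entry at that position and [r] the list of the other entries.  Recursing on
    the list hides all signs and indices. *)
Fixpoint altsum (g : T -> seq T -> R) (l : seq T) : R :=
  if l is b :: l' then g b l' - altsum (fun c r => g c (b :: r)) l' else 0.

Lemma altsum_cons g b l :
  altsum g (b :: l) = g b l - altsum (fun c r => g c (b :: r)) l.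
Proof. by []. Qed.

Lemma eq_altsum g h l : (forall b r, (size r).+1 = size l -> g b r = h b r) ->
  altsum g l = altsum h l.
Proof.
elim: l g h => //= b l IHl g h gh; rewrite gh //; congr (_ - _).
by apply: IHl => c r sz; apply: gh; rewrite /= sz.
Qed.

Lemma altsumB g h l :
  altsum (fun b r => g b r - h b r) l = altsum g l - altsum h l.
Proof.
elim: l g h => [|b l IHl] g h /=; first by rewrite subr0.
by rewrite IHl !opprD !opprK addrACA.
Qed.

Lemma altsumMl x g l : altsum (fun b r => x * g b r) l = x * altsum g l.
Proof.
elim: l g => [|b l IHl] g /=; first by rewrite mulr0.
by rewrite IHl mulrBr.
Qed.

Lemma altsumN g l : altsum (fun b r => - g b r) l = - altsum g l.
Proof.
elim: l g => [|b l IHl] g /=; first by rewrite oppr0.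
by rewrite IHl opprD.
Qed.

Lemma altsumD g h l :
  altsum (fun b r => g b r + h b r) l = altsum g l + altsum h l.
Proof.
rewrite -[altsum h l]opprK -altsumN -altsumB; apply: eq_altsum => b r _.
by rewrite opprK.
Qed.

Lemma altsum_sum I (r : seq I) (h : I -> T -> seq T -> R) l :
  altsum (fun b s => \sum_(i <- r) h i b s) l = \sum_(i <- r) altsum (h i) l.
Proof.
elim: l h => [|b l IHl] h /=; first by rewrite big1.
by rewrite (IHl (fun i c s => h i c (b :: s))) -sumrB.
Qed.

(** Extracting two entries in succession produces each unordered pair twice, with
    opposite signs. *)
Lemma altsum_anti (h : T -> T -> seq T -> R) l :
  altsum (fun c r => altsum (fun d s => h c d s) r) l =
  - altsum (fun c r => altsum (fun d s => h d c s) r) l.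
Proof.
elim: l h => [|e l IHl] h /=; first by rewrite oppr0.
rewrite !altsumB (IHl (fun c d s => h c d (e :: s))).
by rewrite !opprD !opprK addrCA addrA.
Qed.

Lemma altsum_swap g l1 a b l2 :
  (forall c r1 r2, (size r1 + size r2).+1 = (size l1 + size l2)%N ->
     g c (r1 ++ a :: b :: r2) = - g c (r1 ++ b :: a :: r2)) ->
  altsum g (l1 ++ a :: b :: l2) = - altsum g (l1 ++ b :: a :: l2).
Proof.
elim: l1 g => [|c l1 IHl] g /= gab.
  rewrite (eq_altsum (h := fun c r => - g c (b :: a :: r))); last first.
    by move=> c r sz; apply: (gab c [::]).
  by rewrite altsumN; ring.
rewrite gab // (IHl (fun d r => g d (c :: r))); first by ring.
by move=> d r1 r2 sz; apply: (gab d (c :: r1)); rewrite /= !addSn sz.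
Qed.

Variable f : T -> T -> R.

(** The Pfaffian of [f] on a list of [2 * n] indices, by expansion along the first
    one.  Unlike the definition by perfect matchings it can be computed, and
    indices may be repeated, permuted or replaced by vectors. *)
Fixpoint pfl n (l : seq T) : R :=
  if n is n'.+1 then
    if l is a :: l' then altsum (fun b r => f a b * pfl n' r) l' else 0
  else 1.

Lemma pfl_cons n a l :
  pfl n.+1 (a :: l) = altsum (fun b r => f a b * pfl n r) l.
Proof. by []. Qed.

Hypothesis fskew : forall a b, f a b = - f b a.

(** When the two exchanged entries come first, both sides are expanded twice and
    compared by [altsum_anti]; otherwise the exchange commutes with the expansion. *)
Lemma pfl_swap n l1 a b l2 : size (l1 ++ a :: b :: l2) = n.*2 ->
  pfl n (l1 ++ a :: b :: l2) = - pfl n (l1 ++ b :: a :: l2).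
Proof.
elim: n l1 l2 => [|n IHn] [|c l1] l2 //=; rewrite doubleS => -[sz].
  rewrite opprB fskew mulNr addrC; congr (_ - _).
  case: n IHn sz => [|n] IHn sz; first by case: l2 sz => //=; rewrite oppr0.
  have E x y : altsum (fun c r => f x c * pfl n.+1 (y :: r)) l2 =
      altsum (fun c r => altsum (fun d s => f x c * f y d * pfl n s) r) l2.
    apply: eq_altsum => c r _ /=; rewrite -altsumMl; apply: eq_altsum => d s _.
    by rewrite mulrA.
  rewrite !E [RHS](altsum_anti (fun c d s => f b c * f a d * pfl n s)).
  congr (- _); apply: eq_altsum => c r _; apply: eq_altsum => d s _.
  by rewrite [f b d * _]mulrC.
apply: (altsum_swap (g := fun x r => f c x * pfl n r)) => d r1 r2 sz'.
by rewrite IHn ?mulrN //; move: sz; rewrite !size_cat /=; lia.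
Qed.

End ListPfaffian.

Lemma eq_pfl (R : comNzRingType) (T : Type) (f g : T -> T -> R) n l :
  f =2 g -> pfl f n l = pfl g n l.
Proof.
move=> fg; elim: n l => [|n IHn] [|a l] //; rewrite !pfl_cons.
by apply: eq_altsum => b r _; rewrite fg IHn.
Qed.

Lemma rmorph_pfl (R S : comNzRingType) (phi : {rmorphism R -> S}) (T : Type)
  (f : T -> T -> R) n l : phi (pfl f n l) = pfl (fun a b => phi (f a b)) n l.
Proof.
elim: n l => [|n IHn] [|a l]; rewrite ?rmorph1 ?rmorph0 // !pfl_cons.
suff E (h : T -> seq T -> R) s : phi (altsum h s) = altsum (fun b r => phi (h b r)) s.
  by rewrite E; apply: eq_altsum => b r _; rewrite rmorphM IHn.
elim: s h => [|b s IHs] h; first by rewrite rmorph0.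
by rewrite !altsum_cons rmorphB IHs.
Qed.

Section ListPfaffianSign.
Variables (R : comNzRingType) (T : eqType) (f : T -> T -> R).
Hypothesis fskew : forall a b, f a b = - f b a.

Lemma pfl_front n a l1 l2 : size (l1 ++ a :: l2) = n.*2 ->
  pfl f n (l1 ++ a :: l2) = (-1) ^+ size l1 * pfl f n (a :: l1 ++ l2).
Proof.
elim/last_ind: l1 l2 => [|l1 b IHl] l2 sz; first by rewrite expr0 mul1r.
rewrite cat_rcons in sz *; rewrite pfl_swap // IHl; last first.
  by move: sz; rewrite !size_cat /=.
by rewrite size_rcons exprS mulN1r mulNr cat_rcons.
Qed.

Lemma pfl_perm_cat n l s t : perm_eq s t -> size (l ++ s) = n.*2 ->
  exists b : bool, pfl f n (l ++ s) = (-1) ^+ b * pfl f n (l ++ t).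
Proof.
elim: s l t => [|a s IHs] l t st sz.
  have -> : t = [::] by apply/perm_nilP; rewrite perm_sym.
  by exists false; rewrite mul1r.
have at_ : a \in t by rewrite -(perm_mem st) mem_head.
case/splitPr: at_ st => t1 t2; rewrite perm_sym perm_catC /= perm_cons perm_catC => st.
have [||b] := IHs (rcons l a) (t1 ++ t2); first by rewrite perm_sym.
  by rewrite cat_rcons.
rewrite !cat_rcons => ->.
have szt : (size t1 + size t2)%N = size s by rewrite -(perm_size st) size_cat.
exists (b (+) odd (size t1)).
rewrite (pfl_front (l1 := l)); last first.
  by move: sz; rewrite !size_cat /= size_cat szt.
rewrite [l ++ t1 ++ _ :: _]catA pfl_front; last first.
  by move: sz szt; rewrite !size_cat /=; lia.
rewrite signr_addb signr_odd size_cat exprD -catA !mulrA; congr (_ * _).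
by rewrite [RHS]mulrAC -[_ * _ * (-1) ^+ size t1]mulrA -expr2 sqrr_sign mulr1.
Qed.

Lemma pfl_nuniq n l : (forall x : R, x + x = 0 -> x = 0) -> ~~ uniq l ->
  size l = n.*2 -> pfl f n l = 0.
Proof.
move=> char2 ul sz.
have [a [l' ll']] : exists a l', perm_eq l (a :: a :: l').
  elim: l ul {sz} => //= a l IHl; rewrite negb_and negbK => /orP[al|/IHl[b [l' ll']]].
    by exists a, (rem a l); rewrite perm_cons perm_to_rem.
  exists b, (a :: l'); rewrite -(perm_cons a) in ll'; apply: (perm_trans ll').
  by rewrite -[_ :: _ :: _ :: _]/([:: a] ++ [:: b; b] ++ l') perm_catCA.
have [b] := @pfl_perm_cat n [::] _ _ ll' sz.
rewrite /= => ->; have szl := perm_size ll'.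
suff -> : pfl f n (a :: a :: l') = 0 by rewrite mulr0.
apply: char2; rewrite {1}(@pfl_swap _ _ _ fskew n [::] a a l') ?addNr //.
by rewrite -sz szl.
Qed.

Lemma pfl_linear I (r : seq I) n (c : I -> R) v (w : I -> T) l :
  (0 < n)%N -> (forall y, f v y = \sum_(i <- r) c i * f (w i) y) ->
  pfl f n (v :: l) = \sum_(i <- r) c i * pfl f n (w i :: l).
Proof.
case: n => // n _ fv; rewrite pfl_cons.
under eq_bigr => i _ do rewrite pfl_cons -altsumMl.
rewrite -altsum_sum; apply: eq_altsum => b s _.
by rewrite fv mulr_suml; apply: eq_bigr => i _; rewrite mulrA.
Qed.

End ListPfaffianSign.

(** * Expansion of the Pfaffian along its first row *)

Section PfaffianExpansion.
Variable (R : comNzRingType).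

Lemma mkseqSl (T : Type) (u : nat -> T) m :
  mkseq u m.+1 = u 0%N :: mkseq (u \o S) m.
Proof. by rewrite /mkseq /= (iotaDl 1 0) -map_comp. Qed.

Lemma altsum_mkseq (T : Type) (g : T -> seq T -> R) u m :
  altsum g (mkseq u m.+1) =
  \sum_(j < m.+1) (-1) ^+ j * g (u j) (mkseq (u \o bump j) m).
Proof.
elim: m u g => [|m IHm] u g.
  by rewrite big_ord1 /= expr0 mul1r subr0.
rewrite mkseqSl big_ord_recl expr0 mul1r.
rewrite altsum_cons IHm.
congr (_ + _); rewrite -sumrN; apply: eq_bigr => j _; rewrite exprS mulN1r mulNr.
case: m j {IHm} => [|m] j; first by case: j.
rewrite [in RHS]mkseqSl; congr (- (_ * g _ (_ :: _))).
by apply: eq_mkseq => i /=; rewrite bumpS.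
Qed.

(** Permutations are handled through their values on natural numbers, so that
    permutations of [m] and of [m.+2] indices can be compared without casts. *)
Definition vals m (s : 'S_m) i : nat := if insub i is Some o then s o else i.

Definition nmatch n (v : nat -> nat) : bool :=
  [forall i : 'I_n, v i.*2 < v i.*2.+1]%N &&
  [forall i : 'I_n, forall j : 'I_n, (i < j) ==> (v i.*2 < v j.*2)]%N.

Definition matchsum m n (G : nat -> nat -> R) :=
  \sum_(s : 'S_m | nmatch n (vals s))
    (-1) ^+ s * \prod_(i < n) G (vals s i.*2) (vals s i.*2.+1).

Lemma valsE m (s : 'S_m) (i : 'I_m) : vals s i = s i.
Proof. by rewrite /vals valK. Qed.

Lemma vals_lift0 m j (s : 'S_m) : vals (lift_perm ord0 j s) 0 = j.
Proof. by rewrite (valsE _ ord0) lift_perm_id. Qed.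

Lemma vals_liftS m (j : 'I_m.+1) (s : 'S_m) i :
  vals (lift_perm ord0 j s) i.+1 = bump j (vals s i).
Proof.
have [im|im] := ltnP i m.
  rewrite (valsE s (Ordinal im)).
  rewrite -[i.+1]/(nat_of_ord (lift ord0 (Ordinal im))) valsE.
  by rewrite lift_perm_lift.
rewrite /vals !insubF //; try by apply/negbTE; rewrite -leqNgt.
by rewrite /bump (leq_trans _ im) // -ltnS.
Qed.

(** [lift_perm i j] is a bijection onto the permutations mapping [i] to [j]. *)
Lemma sum_lift_perm m i j (P : pred 'S_m.+1) (F : 'S_m.+1 -> R) :
  \sum_(s : 'S_m.+1 | P s && (s i == j)) F s =
  \sum_(s : 'S_m | P (lift_perm i j s)) F (lift_perm i j s).
Proof.
have inj : injective (@lift_perm m i j).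
  move=> s t /permP st; apply/permP => x; apply: (@lift_inj _ j).
  by rewrite -!(lift_perm_lift i).
have surj (s : 'S_m.+1) : s i = j -> exists t, lift_perm i j t = s.
  move=> sij; pose g x := odflt x (unlift j (s (lift i x))).
  have gE x : lift j (g x) = s (lift i x).
    rewrite /g; have [y ->//|sj] := unliftP j (s (lift i x)).
    by have /eqP := neq_lift i x; case; apply: (@perm_inj _ s); rewrite sij sj.
  have g_inj : injective g.
    by move=> x y gxy; apply/(@lift_inj _ i)/(@perm_inj _ s); rewrite -!gE gxy.
  exists (perm g_inj); apply/permP => x; have [y ->|->] := unliftP i x.
    by rewrite lift_perm_lift permE gE.
  by rewrite lift_perm_id sij.
pose preimage s := [pick t | lift_perm i j t == s].
rewrite (reindex_omap (lift_perm i j) preimage) => [|s /andP[_ /eqP/surj[t ts]]].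
  apply: eq_bigl => s; rewrite lift_perm_id eqxx andbT /preimage.
  case: pickP => [t /eqP/inj->|/(_ s)]; last by rewrite eqxx.
  by rewrite eqxx andbT.
by rewrite /preimage; case: pickP => [t' /eqP<-//|/(_ t)]; rewrite ts eqxx.
Qed.

Lemma forall_ordS n (P : pred nat) :
  [forall i : 'I_n.+1, P i] = P 0%N && [forall i : 'I_n, P i.+1].
Proof.
apply/forallP/andP => [H|[H0 /forallP H] i].
  by split; [apply: (H ord0) | apply/forallP => i; apply: (H (lift ord0 i))].
by case: (unliftP ord0 i) => [k|] ->; [apply: H | apply: H0].
Qed.

Lemma nmatchS n v w j : v 0%N = 0%N -> v 1%N = j.+1 ->
  (forall i, v i.+2 = (bump j (w i)).+1) -> nmatch n.+1 v = nmatch n w.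
Proof.
move=> v0 v1 v2; rewrite /nmatch.
rewrite (forall_ordS _ (fun i => v i.*2 < v i.*2.+1)%N) /= v0 v1 /=.
rewrite (forall_ordS _ (fun i => [forall k : 'I_n.+1, (i < k)%N ==> (v i.*2 < v k.*2)%N])) /=.
have -> : [forall k : 'I_n.+1, (0 < k) ==> (v 0.*2 < v k.*2)]%N.
  apply/forallP => -[[|k] hk] //=; rewrite v0 doubleS v2 //.
have lb a b : (bump j a < bump j b)%N = (a < b)%N by rewrite /bump; lia.
congr (_ && _); apply: eq_forallb => i; first by rewrite doubleS !v2 ltnS lb.
rewrite (forall_ordS _ (fun k => (i.+1 < k)%N ==> (v i.+1.*2 < v k.*2)%N)) /=.
by apply: eq_forallb => k; rewrite !doubleS !v2 !ltnS lb.
Qed.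

(** A matching lists the pair containing the least index first, and that index
    first in its pair. *)
Lemma nmatch_first m n (s : 'S_m.+2) :
  m = n.*2 -> nmatch n.+1 (vals s) -> s ord0 = ord0.
Proof.
move=> mn /andP[/forallP s1 /forallP s2]; pose k := (s^-1)%g ord0.
have sk : s k = ord0 by rewrite permKV.
suff k0 : k = ord0 by rewrite -{1}k0.
have vk : vals s k = 0%N by rewrite valsE sk.
apply/val_inj; rewrite /= -[k : nat]odd_double_half.
have kn : (k./2 < n.+1)%N by have := ltn_ord k; lia.
move: vk; rewrite -[k : nat]odd_double_half.
case: (odd k); first by have := s1 (Ordinal kn); rewrite /= add1n => + v0; rewrite v0.
case: (posnP k./2) => [->//|k0]; have /forallP/(_ (Ordinal kn))/= := s2 ord0.
by rewrite k0 /= add0n => + v0; rewrite v0.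
Qed.

(** Summing over the partner [j.+1] of the index [0]; the remaining pairs form a
    matching of the other indices, reached through two successive lifts. *)
Lemma matchsumS m n G : m = n.*2 -> matchsum m.+2 n.+1 G =
  \sum_(j < m.+1) (-1) ^+ j * G 0%N j.+1 *
     matchsum m n (fun a b => G (bump j a).+1 (bump j b).+1).
Proof.
move=> mn; rewrite /matchsum.
under eq_bigl => s.
  have -> : nmatch n.+1 (vals s) = nmatch n.+1 (vals s) && (s ord0 == ord0).
    by apply/idP/andP => [H|[]//]; split=> //; rewrite (nmatch_first mn H).
  over.
rewrite sum_lift_perm (partition_big (fun t : 'S_m.+1 => t ord0) predT) //=.
apply: eq_bigr => j _; rewrite sum_lift_perm big_distrr /=.
have vE (s : 'S_m) i :
    vals (lift_perm ord0 ord0 (lift_perm ord0 j s)) i.+2 = (bump j (vals s i)).+1.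
  by rewrite !vals_liftS.
have v0 (s : 'S_m) : vals (lift_perm ord0 ord0 (lift_perm ord0 j s)) 0 = 0%N.
  by rewrite vals_lift0.
have v1 (s : 'S_m) : vals (lift_perm ord0 ord0 (lift_perm ord0 j s)) 1 = j.+1.
  by rewrite vals_liftS vals_lift0.
apply: eq_big => [s|s _]; first exact: nmatchS (v0 s) (v1 s) (vE s).
rewrite big_ord_recl /= v0 v1 !odd_lift_perm /=.
under eq_bigr => i _ do rewrite doubleS !vE.
by rewrite signr_addb signr_odd mulrACA.
Qed.

Lemma pfaffian_matchsum n (G : nat -> nat -> R) :
  pfaffian (\matrix_(i < 2 * n, j < 2 * n) G i j) = matchsum (2 * n) n G.
Proof.
rewrite /pfaffian; apply: eq_big => [s|s _].
  rewrite /pf_matching /nmatch; congr (_ && _).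
    by apply: eq_forallb => i; rewrite -[i.*2]/(val (pf_fst i)) -[i.*2.+1]/(val (pf_snd i)) !valsE.
  apply: eq_forallb => i; apply: eq_forallb => j.
  by rewrite -[i.*2]/(val (pf_fst i)) -[j.*2]/(val (pf_fst j)) !valsE.
congr (_ * _); apply: eq_bigr => i _; rewrite mxE.
by rewrite -[i.*2]/(val (pf_fst i)) -[i.*2.+1]/(val (pf_snd i)) !valsE.
Qed.

Lemma pfaffian_pfl (T : Type) (f : T -> T -> R) n (u : nat -> T) :
  pfaffian (\matrix_(i < 2 * n, j < 2 * n) f (u i) (u j)) =
  pfl f n (mkseq u (2 * n)).
Proof.
rewrite (pfaffian_matchsum _ (fun a b => f (u a) (u b))).
elim: n u => [|n IHn] u.
  rewrite /matchsum (big_pred1 1%g) ?big_ord0 /=; first by rewrite odd_perm1 mul1r.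
  move=> s; rewrite /nmatch; have -> : s = 1%g by apply/permP => -[].
  by rewrite /= eqxx; apply/andP; split; apply/forallP => -[].
rewrite mulnS matchsumS ?mul2n //.
rewrite mkseqSl pfl_cons altsum_mkseq.
by rewrite -mul2n; apply: eq_bigr => j _; rewrite -IHn mulrA.
Qed.

End PfaffianExpansion.

(** * Pfaffians of congruent matrices *)

Section Congruence.
Variables (k : fieldType) (R : comNzRingType) (phi : {rmorphism k -> R}).
Hypothesis char2 : forall x : R, x + x = 0 -> x = 0.
Variables (n : nat) (M : 'M[R]_(2 * n)).
Hypothesis Mskew : M^T = - M.

(** The bilinear form of [M] on vectors with entries in [k]. *)
Definition gram (x y : 'rV[k]_(2 * n)) : R :=
  (map_mx phi x *m M *m (map_mx phi y)^T) 0 0.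

Definition nat_row (P : 'M[k]_(2 * n)) (i : nat) : 'rV[k]_(2 * n) :=
  oapp (fun o => row o P) 0 (insub i).

Lemma gramC x y : gram x y = - gram y x.
Proof.
have E : map_mx phi x *m M *m (map_mx phi y)^T =
    - (map_mx phi y *m M *m (map_mx phi x)^T)^T.
  by rewrite !trmx_mul trmxK Mskew mulNmx mulmxN opprK mulmxA.
by rewrite /gram [in LHS]E [LHS]mxE; congr (- _); rewrite [LHS]mxE.
Qed.

Lemma gramDl I (r : seq I) (F : I -> 'rV[k]_(2 * n)) (c : I -> k) y :
  gram (\sum_(i <- r) c i *: F i) y = \sum_(i <- r) phi (c i) * gram (F i) y.
Proof.
rewrite /gram raddf_sum !mulmx_suml summxE; apply: eq_bigr => i _.
by rewrite /= map_mxZ -!scalemxAl mxE.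
Qed.

Lemma pfaffian_rows P :
  pfaffian (map_mx phi P *m M *m (map_mx phi P)^T) = pfl gram n (mkseq (nat_row P) (2 * n)).
Proof.
rewrite -pfaffian_pfl; congr pfaffian; apply/matrixP => i j; rewrite mxE.
rewrite /nat_row !valK /= /gram !map_row -row_mul.
by rewrite [in RHS]mxE [in LHS]mxE; apply: eq_bigr => l _; rewrite !mxE.
Qed.

(** On basis vectors only lists without repetition contribute, and these are
    permutations of the full list of indices. *)
Lemma pfl_basis (l : seq 'I_(2 * n)) : size l = n.*2 ->
  exists c, pfl gram n (map (fun i => delta_mx 0 i) l) = phi c * pfaffian M.
Proof.
move=> sz; have gramE i j : gram (delta_mx 0 i) (delta_mx 0 j) = M i j.
  by rewrite /gram !map_delta_mx -rowE trmx_delta -colE !mxE.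
have [ul|ul] := boolP (uniq l); last first.
  exists 0; rewrite rmorph0 mul0r; apply: (pfl_nuniq gramC) => //; last by rewrite size_map.
  by apply: contra ul; apply: map_uniq.
have -> : pfaffian M = pfl gram n (map (fun i => delta_mx 0 i) (enum 'I_(2 * n))).
  have := pfaffian_rows 1%:M; rewrite map_mx1 trmx1 mulmx1 mul1mx => ->.
  congr pfl; rewrite /mkseq -val_enum_ord -map_comp; apply: eq_map => i /=.
  by rewrite /nat_row valK /= row1.
have [||b ->] := @pfl_perm_cat _ _ _ gramC n [::] (map (fun i => delta_mx 0 i) l)
  (map (fun i => delta_mx 0 i) (enum 'I_(2 * n))).
- apply/perm_map/uniq_perm; rewrite ?enum_uniq // => i; rewrite mem_enum inE.
  have [||_ ->] := uniq_min_size ul (s2 := enum 'I_(2 * n)); last exact: mem_enum.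
  + by move=> j _; rewrite mem_enum.
  + by rewrite size_enum_ord sz mul2n.
- by rewrite size_map.
by exists ((-1) ^+ b); rewrite rmorphXn rmorphN1.
Qed.

(** By linearity in one entry at a time, arbitrary vectors reduce to basis vectors. *)
Lemma pfl_vectors (l : seq 'I_(2 * n)) (vs : seq 'rV[k]_(2 * n)) :
  (size l + size vs)%N = n.*2 ->
  exists c, pfl gram n (map (fun i => delta_mx 0 i) l ++ vs) = phi c * pfaffian M.
Proof.
elim: vs l => [|v vs IHvs] l sz.
  by rewrite cats0; apply: pfl_basis; rewrite -sz addn0.
have IH i : exists c, pfl gram n (map (fun i => delta_mx 0 i) l ++ delta_mx 0 i :: vs)
    = phi c * pfaffian M.
  have [|c] := IHvs (rcons l i); first by rewrite size_rcons addSn -addnS.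
  by rewrite map_rcons cat_rcons => ->; exists c.
have szl i : size (map (fun i => delta_mx 0 i : 'rV[k]_(2 * n)) l ++ i :: vs) = n.*2.
  by rewrite size_cat size_map.
suff -> : pfl gram n (map (fun i => delta_mx 0 i) l ++ v :: vs) =
    \sum_i phi (v 0 i) * pfl gram n (map (fun i => delta_mx 0 i) l ++ delta_mx 0 i :: vs).
  elim/big_ind: _ => [|_ _ [c ->] [e ->]|i _].
  - by exists 0; rewrite rmorph0 mul0r.
  - by exists (c + e); rewrite rmorphD mulrDl.
  - by have [c ->] := IH i; exists (v 0 i * c); rewrite rmorphM mulrA.
have n0 : (0 < n)%N by rewrite -double_gt0 -(szl v) size_cat addnS.
rewrite (pfl_front gramC) //; under eq_bigr => i _ do rewrite (pfl_front gramC) // mulrCA.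
rewrite -mulr_sumr; congr (_ * _); apply: pfl_linear => // y.
by rewrite {1}[v]row_sum_delta gramDl.
Qed.

(** Congruence by a matrix over [k] does not change the hypersurface defined by the
    Pfaffian.  The scalar [c] is [\det P]. *)
Lemma pfaffian_congr P :
  exists c, pfaffian (n := n) (map_mx phi P *m M *m (map_mx phi P)^T) = phi c * pfaffian M.
Proof.
rewrite pfaffian_rows; apply: (pfl_vectors (l := [::])).
by rewrite size_mkseq mul2n.
Qed.

End Congruence.

(** * Polynomial functions in characteristic zero *)

Section InfiniteField.
Variable k : fieldType.
Hypothesis char0 : [pchar k] =i pred0.

Lemma char0_natr_inj : injective (fun n : nat => n%:R : k).
Proof.
have W (i j : nat) : (i <= j)%N -> i%:R = j%:R :> k -> i = j.
  move=> ij /esym/eqP; rewrite -subr_eq0 -natrB // => /eqP ji0.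
  apply/eqP; rewrite eqn_leq ij -subn_eq0; apply/eqP.
  by apply/eqP; rewrite -((pcharf0P _).1 char0) ji0.
move=> i j ij; case/orP: (leq_total i j) => le; first exact: W.
by apply/esym/W => //; rewrite ij.
Qed.

Lemma poly_nonroot (q : {poly k}) : q != 0 -> exists i : nat, q.[i%:R] != 0.
Proof.
move=> q0; pose s : seq k := [seq i%:R | i <- iota 0 (size q)].
have us : uniq s by rewrite map_inj_uniq ?iota_uniq //; apply: char0_natr_inj.
have : ~~ all (root q) s.
  apply/negP => sq; have := max_poly_roots q0 sq us.
  by rewrite size_map size_iota ltnn.
by case/allPn => _ /mapP[i _ ->] ri; exists i.
Qed.

Lemma poly_fun_eq0 (q : {poly k}) : (forall x, q.[x] = 0) -> q = 0.
Proof.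
by move=> q0; apply/eqP/negP => /negP/poly_nonroot[i]; rewrite q0 eqxx.
Qed.

(** [mnm_init] forgets the last exponent: with it, [muni] is seen to be injective
    and to compute evaluations. *)
Definition mnm_init n (m : 'X_{1..n.+1}) : 'X_{1..n} :=
  [multinom m (widen_ord (leqnSn n) i) | i < n].

Lemma mnm_split n (m m' : 'X_{1..n.+1}) :
  mnm_init m = mnm_init m' -> m ord_max = m' ord_max -> m = m'.
Proof.
move=> /mnmP mi mx; apply/mnmP => i; have [i0|] := unliftP ord_max i; last by move->.
move=> ->; have -> : lift ord_max i0 = widen_ord (leqnSn n) i0.
  by apply: val_inj; rewrite /= /bump leqNgt ltn_ord.
by have := mi i0; rewrite !mnmE.
Qed.

Lemma mcoeff_muni n (p : {mpoly k[n.+1]}) m :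
  ((muni p)`_(m ord_max))@_(mnm_init m) = p@_m.
Proof.
rewrite muniE coef_sum raddf_sum /=.
have E m' : (p@_m' *: 'X_[mnm_init m'] *: 'X^(m' ord_max))`_(m ord_max)@_(mnm_init m)
    = p@_m' * (m' == m)%:R.
  rewrite coefZ coefXn; have [->|m'm] := eqVneq m' m.
    by rewrite eqxx mulr1 mcoeffZ mcoeffX eqxx.
  have [x|_] := eqVneq (m ord_max) (m' ord_max); last by rewrite mulr0 mcoeff0 mulr0.
  rewrite mulr1 mcoeffZ mcoeffX; case: eqVneq => [y|]; last by [].
  by rewrite (mnm_split y (esym x)) eqxx in m'm.
under eq_bigr => m' _ do rewrite -/(mnm_init m') E.
have [mp|mp] := boolP (m \in msupp p).
  rewrite (bigD1_seq m) ?msupp_uniq //= eqxx mulr1 big1 ?addr0 // => m' /negPf->.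
  by rewrite mulr0.
rewrite memN_msupp_eq0 // big_seq big1 // => m' m'p.
by case: eqVneq mp => [<-|]; rewrite ?m'p ?mulr0.
Qed.

Lemma meval_muni n (p : {mpoly k[n.+1]}) (v : 'I_n.+1 -> k) :
  p.@[v] = (map_poly (meval (v \o widen_ord (leqnSn n))) (muni p)).[v ord_max].
Proof.
rewrite muniE mevalE rmorph_sum horner_sum; apply: eq_bigr => m _ /=.
rewrite map_polyZ /= hornerZ rmorphXn /= map_polyX hornerXn mevalZ mevalX big_ord_recr /= mulrA.
by congr (_ * _ * _); apply: eq_bigr => i _; rewrite mnmE.
Qed.

Lemma mpoly_nonroot n (p : {mpoly k[n]}) : p != 0 -> exists v, p.@[v] != 0.
Proof.
elim: n p => [|n IHn] p p0.
  by exists (fun=> 0); move: p0; rewrite [p]nvar0_mpolyC mevalC mpolyC_eq0.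
have q0 : muni p != 0.
  apply: contra_neq p0 => q0; apply/mpolyP => m.
  by rewrite -mcoeff_muni q0 coef0 !mcoeff0.
have [v vl] : exists v, (lead_coef (muni p)).@[v] != 0.
  by apply: IHn; rewrite lead_coef_eq0.
have [i xi] : exists i : nat, (map_poly (meval v) (muni p)).[i%:R] != 0.
  apply: poly_nonroot; apply: contra_neq vl => /polyP/(_ (size (muni p)).-1).
  by rewrite coef_map coef0.
exists (fun j => oapp v i%:R (unlift ord_max j)).
rewrite meval_muni unlift_none /=; move: xi; congr (_ != 0); congr (_.[_]).
apply: eq_map_poly => q; apply: meval_eq => j /=.
have -> : widen_ord (leqnSn n) j = lift ord_max j.
  by apply: val_inj; rewrite /= /bump leqNgt ltn_ord.
by rewrite liftK.
Qed.

Lemma horner_mmap n (P : {mpoly k[n]}) (gam : 'I_n -> {poly k}) t :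
  (mmap polyC gam P).[t] = P.@[fun i => (gam i).[t]].
Proof.
rewrite mevalE horner_sum; apply: eq_bigr => m _.
rewrite hornerM hornerC horner_prod; congr (_ * _).
by apply: eq_bigr => i _; rewrite horner_exp.
Qed.

Lemma msizeM_leq n (p q : {mpoly k[n]}) s t :
  (msize p <= s.+1)%N -> (msize q <= t.+1)%N -> (msize (p * q) <= (s + t).+1)%N.
Proof.
have [->|p0] := eqVneq p 0; first by rewrite mul0r msize0.
have [->|q0] := eqVneq q 0; first by rewrite mulr0 msize0.
by rewrite msizeM //; move: (msize p) (msize q) => a b; lia.
Qed.

Lemma msizeX_leq n (p : {mpoly k[n]}) D e :
  (msize p <= D)%N -> (msize (p ^+ e) <= (e * D).+1)%N.
Proof.
move=> pD; elim: e => [|e IHe]; first by rewrite expr0 msize1.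
by rewrite exprS mulSn; apply: msizeM_leq => //; apply: leqW.
Qed.

(** The polynomials in [f_1, .., f_N] with all exponents below [E] form a space of
    dimension [E ^ N], if the [f_i] are independent.  They have degree linear in
    [E], so that they live in a space of dimension [O(E ^ m)]: a contradiction for
    large [E] if [m < N]. *)
Lemma mpoly_dependent m N (f : N.-tuple {mpoly k[m]}) : (m < N)%N ->
  exists2 P : {mpoly k[N]}, P != 0 & P \mPo f = 0.
Proof.
move=> mN; pose D := \max_(i < N) msize (tnth f i).
pose E := ((N * D).+1 ^ m).+1; pose B := (N * (E * D)).+1.
pose mon (a : {ffun 'I_N -> 'I_E}) : 'X_{1..N} := [multinom (a i : nat) | i < N].
have mon_inj : injective mon.
  by move=> a b /mnmP ab; apply/ffunP => i; apply: val_inj; have := ab i; rewrite !mnmE.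
have msf a : (msize ('X_[mon a] \mPo f) <= B)%N.
  rewrite comp_mpolyX; apply: (@leq_trans (\sum_(i < N) a i * D).+1).
    apply: (big_rec2 (fun p s => msize p <= s.+1)%N); first by rewrite msize1.
    move=> i p s _ ps; apply: msizeM_leq => //; rewrite mnmE; apply: msizeX_leq.
    exact: (leq_bigmax (F := fun i => msize (tnth f i))).
  rewrite ltnS -[N in (N * _)%N]card_ord -sum_nat_const; apply: leq_sum => i _.
  by rewrite leq_mul2r ltnW ?orbT.
pose A := \matrix_(a < #|{: {ffun 'I_N -> 'I_E}}|, b < #|{: 'X_{1..m < B}}|)
  ('X_[mon (enum_val a)] \mPo f)@_(enum_val b).
have cardB : (#|{: 'X_{1..m < B}}| <= B ^ m)%N.
  have inj : injective (fun b : 'X_{1..m < B} => [ffun i => inord (b i)] : {ffun 'I_m -> 'I_B}).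
    move=> a b /ffunP ab; apply/val_inj/mnmP => i; have := ab i; rewrite !ffunE.
    have lt (c : 'X_{1..m < B}) : (c i < B)%N.
      by apply: leq_ltn_trans (bmdeg c); rewrite mdegE (bigD1 i) //= leq_addr.
    by move/(congr1 val); rewrite /= !inordK ?lt.
  by have := leq_card _ inj; rewrite card_ffun !card_ord.
have rk : (\rank A < #|{: {ffun 'I_N -> 'I_E}}|)%N.
  apply: leq_ltn_trans (rank_leq_col _) _; apply: leq_ltn_trans cardB _.
  rewrite card_ffun !card_ord; apply: (@leq_ltn_trans ((E * (N * D).+1) ^ m)).
    have [->//|m0] := posnP m.
    by rewrite leq_exp2r // /B mulnS (mulnCA E) -add1n leq_add2r.
  rewrite expnMn; apply: (@leq_trans (E ^ m.+1)); last exact: leq_pexp2l.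
  by rewrite expnSr ltn_pmul2l ?expn_gt0.
have /rowV0Pn[v vA v0] : kermx A != 0 by rewrite kermx_eq0 /row_free neq_ltn rk.
have {}vA : v *m A = 0 by apply/sub_kermxP.
pose P : {mpoly k[N]} := \sum_a v 0 (enum_rank a) *: 'X_[mon a].
have Pc a : P@_(mon a) = v 0 (enum_rank a).
  rewrite raddf_sum (bigD1 a) //= mcoeffZ mcoeffX eqxx mulr1 big1 ?addr0 // => b ba.
  by rewrite mcoeffZ mcoeffX (inj_eq mon_inj) (negPf ba) mulr0.
exists P.
  apply: contra_neq v0 => P0; apply/rowP => i; rewrite mxE.
  by rewrite -(enum_valK i) -Pc P0 mcoeff0.
apply/mpolyP => b; rewrite mcoeff0.
have [bB|bB] := ltnP (mdeg b) B; last first.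
  apply: memN_msupp_eq0; apply: msize_mdeg_ge; apply: leq_trans bB.
  rewrite /P raddf_sum; apply: leq_trans (msize_sum _ _ _) _; apply/bigmax_leqP => a _.
  by rewrite /= comp_mpolyZ; apply: leq_trans (msizeZ_le _ _) (msf a).
have := congr1 (fun v : 'rV_ _ => v 0 (enum_rank (BMultinom bB))) vA.
rewrite !mxE => <-; rewrite (reindex (@enum_rank {ffun 'I_N -> 'I_E})) /=; last first.
  by apply: onW_bij; apply: enum_rank_bij.
have -> : P \mPo f = \sum_a v 0 (enum_rank a) *: ('X_[mon a] \mPo f).
  by rewrite raddf_sum; apply: eq_bigr => a _; apply: comp_mpolyZ.
by rewrite raddf_sum; apply: eq_bigr => a _; rewrite /= mcoeffZ mxE !enum_rankK.
Qed.

End InfiniteField.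

(** * Images of polynomial maps *)

Section GenericTruth.
Variable k : closedFieldType.
Import GRing.

(** Inverses do not occur in the formulas considered; they are sent to [0]. *)
Fixpoint mpoly_of_term N (t : term k) : {mpoly k[N]} :=
  match t with
  | Var i => if insub i is Some o then 'X_o else 0
  | Const c => c%:MP
  | NatConst n => n%:R
  | Add a b => mpoly_of_term N a + mpoly_of_term N b
  | Opp a => - mpoly_of_term N a
  | NatMul a n => mpoly_of_term N a *+ n
  | Mul a b => mpoly_of_term N a * mpoly_of_term N b
  | Inv a => 0
  | Exp a n => mpoly_of_term N a ^+ n
  end.

Definition env N (v : 'I_N -> k) : seq k := [seq v i | i <- enum 'I_N].

Lemma env_nth N (v : 'I_N -> k) (i : 'I_N) : (env v)`_i = v i.
Proof. by rewrite (nth_map i) ?size_enum_ord // nth_ord_enum. Qed.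

Lemma eval_mpoly_of_term N (t : term k) (v : 'I_N -> k) : rterm t ->
  eval (env v) t = (mpoly_of_term N t).@[v].
Proof.
elim: t => //=.
- move=> i _; case: insubP => [o _ <-|]; first by rewrite env_nth mevalXU.
  by rewrite -leqNgt => Ni; rewrite nth_default ?meval0 // size_map size_enum_ord.
- by move=> c _; rewrite mevalC.
- by move=> n _; rewrite rmorph_nat.
- by move=> a IHa b IHb /andP[/IHa-> /IHb->]; rewrite mevalD.
- by move=> a IHa /IHa->; rewrite mevalN.
- by move=> a IHa n /IHa->; rewrite mevalMn.
- by move=> a IHa b IHb /andP[/IHa-> /IHb->]; rewrite mevalM.
- by move=> a IHa n /IHa->; rewrite rmorphXn.
Qed.

(** A boolean function on affine space is generically constant if it is constant on
    a nonempty open subset. *)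
Definition generically N (F : ('I_N -> k) -> bool) :=
  exists2 P : {mpoly k[N]}, P != 0 &
    exists b : bool, forall v, P.@[v] != 0 -> F v = b.

Lemma generically_op N (op : bool -> bool -> bool) F G :
  @generically N F -> @generically N G -> generically (fun v => op (F v) (G v)).
Proof.
move=> [P P0 [b Pb]] [Q Q0 [c Qc]]; exists (P * Q); first by rewrite mulf_neq0.
exists (op b c) => v; rewrite mevalM mulf_eq0 negb_or => /andP[Pv Qv].
by rewrite Pb ?Qc.
Qed.

(** A polynomial equation holds either identically or nowhere on a nonempty open
    subset, and nonempty open subsets of affine space meet. *)
Lemma qf_generic N (f : formula k) : qf_form f && rformula f ->
  generically (fun v : 'I_N -> k => qf_eval (env v) f).
Proof.
elim: f => //=.
- by move=> b _; exists 1; [apply: oner_neq0 | exists b].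
- move=> t1 t2 /andP[r1 r2]; pose P := mpoly_of_term N t1 - mpoly_of_term N t2.
  have E v : (eval (env v) t1 == eval (env v) t2) = (P.@[v] == 0).
    by rewrite !eval_mpoly_of_term // -subr_eq0 /P mevalB.
  have [P0|P0] := eqVneq P 0.
    by exists 1; [apply: oner_neq0 | exists true => v _; rewrite E P0 meval0 eqxx].
  by exists P => //; exists false => v /negPf; rewrite E.
- move=> f IHf g IHg; rewrite andbACA => /andP[/IHf F /IHg G].
  exact: (generically_op andb F G).
- move=> f IHf g IHg; rewrite andbACA => /andP[/IHf F /IHg G].
  exact: (generically_op orb F G).
- move=> f IHf g IHg; rewrite andbACA => /andP[/IHf F /IHg G].
  exact: (generically_op implb F G).
by move=> f IHf /IHf F; apply: (generically_op (fun b _ => ~~ b) F F).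
Qed.

Fixpoint term_prod (s : seq (term k)) : term k :=
  if s is t :: s' then Mul t (term_prod s') else NatConst k 1.
Fixpoint term_sum (s : seq (term k)) : term k :=
  if s is t :: s' then Add t (term_sum s') else NatConst k 0.

(** The variables of [p] are shifted by [N], the first [N] ones being kept for a
    point of the target. *)
Definition term_of_mpoly N m (p : {mpoly k[m]}) : term k :=
  term_sum [seq Mul (Const p@_mon)
     (term_prod [seq Exp (Var k (N + i)) (mon i) | i : 'I_m <- enum 'I_m])
     | mon <- msupp p].

Lemma term_of_mpolyP N m (p : {mpoly k[m]}) e :
  eval e (term_of_mpoly N p) = p.@[fun i => e`_(N + i)].
Proof.
have P s : eval e (term_prod s) = \prod_(t <- s) eval e t.
  by elim: s => [|t s IHs]; rewrite ?big_nil ?big_cons //= IHs.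
have S s : eval e (term_sum s) = \sum_(t <- s) eval e t.
  by elim: s => [|t s IHs]; rewrite ?big_nil ?big_cons //= IHs.
rewrite S big_map mevalE; apply: eq_bigr => mon _ /=; congr (_ * _).
by rewrite P big_map big_enum.
Qed.

Lemma rterm_of_mpoly N m (p : {mpoly k[m]}) : rterm (term_of_mpoly N p).
Proof.
rewrite /term_of_mpoly; elim: (msupp p) => //= mon s ->; rewrite andbT.
by elim: (enum 'I_m) => //= i t ->.
Qed.

(** This replaces constructibility of images: over an algebraically closed field
    the statement that [y] has a preimage is equivalent to a quantifier-free
    formula in [y], whose truth value is generically constant. *)
Lemma image_generic N m (f : 'I_N -> {mpoly k[m]}) :
  exists2 P : {mpoly k[N]}, P != 0 &
   (forall y, P.@[y] != 0 -> exists x, forall i, y i = (f i).@[x]) \/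
   (forall x, P.@[fun i => (f i).@[x]] = 0).
Proof.
pose body : formula k := foldr And (Bool true)
  [seq Equal (Var k i) (term_of_mpoly N (f i)) | i : 'I_N <- enum 'I_N].
pose ex := foldr Exists body (iota N m).
have rex : rformula ex.
  rewrite /ex; elim: (iota N m) => //=; rewrite /body.
  by elim: (enum 'I_N) => //= i s ->; rewrite rterm_of_mpoly.
have bodyP e : holds e body <-> forall i : 'I_N, e`_i = (f i).@[fun j => e`_(N + j)].
  suff H s : holds e (foldr And (Bool true)
      [seq Equal (Var k i) (term_of_mpoly N (f i)) | i : 'I_N <- s]) <->
      forall i, i \in s -> e`_i = (f i).@[fun j => e`_(N + j)].
    split=> [/H B i|B]; first by apply: B; rewrite mem_enum.
    by apply/H => i _; apply: B.
  elim: s => [|i s IHs] //=; rewrite term_of_mpolyP; split.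
    by case=> ei /IHs B j; rewrite inE => /predU1P[->|/B].
  move=> B; split; first by apply: B; rewrite mem_head.
  by apply/IHs => j js; apply: B; rewrite inE js orbT.
have exP (y : 'I_N -> k) : holds (env y) ex <-> exists x, forall i, y i = (f i).@[x].
  split=> [/foldExistsP[e ye /bodyP B]|[x xy]].
    exists (fun j => e`_(N + j)) => i; rewrite -B -ye ?env_nth //.
    by rewrite !inE mem_iota leqNgt ltn_ord.
  apply/foldExistsP; exists (env y ++ [seq x j | j <- enum 'I_m]).
    move=> i; rewrite !inE mem_iota nth_cat size_map size_enum_ord.
    case: (ltnP i N) => // Ni mi; rewrite [LHS]nth_default; last by rewrite size_map size_enum_ord.
    by rewrite nth_default // size_map size_enum_ord leq_subRL // leqNgt.
  apply/bodyP => i; rewrite nth_cat size_map size_enum_ord ltn_ord env_nth xy.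
  apply: meval_eq => j; rewrite nth_cat size_map size_enum_ord ltnNge leq_addr /=.
  by rewrite addKn (nth_map j) ?size_enum_ord // nth_ord_enum.
have [P P0 [b Pb]] :=
  qf_generic N (quantifier_elim_wf (@ClosedFieldQE.wf_ex_elim k) rex).
have elimP e := quantifier_elim_rformP (@ClosedFieldQE.wf_ex_elim k)
  (ClosedFieldQE.holds_ex_elim (@solve_monicpoly k)) e rex.
exists P => //; case: b Pb => Pb; [left=> y Py|right=> x].
  by apply/exP/elimP; rewrite Pb.
apply/eqP/negPn/negP => /Pb/negbT/elimP; apply; apply/exP; by exists x.
Qed.

End GenericTruth.

Section Curve.
Variable k : fieldType.
Hypothesis char0 : [pchar k] =i pred0.

(** If [P] vanishes on curves through [y0] with every velocity [w], then its lowest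
    nonzero homogeneous part at [y0] vanishes at every [w]: this part is the leading
    coefficient, in the parameter of the curve, of [P] along the curve. *)
Lemma mpoly_curve N (P : {mpoly k[N]}) (y0 : 'I_N -> k) :
  (forall w : 'I_N -> k, exists gam : 'I_N -> {poly k},
     [/\ forall i, (gam i)`_0 = y0 i, forall i, (gam i)`_1 = w i
       & forall t, P.@[fun i => (gam i).[t]] = 0]) ->
  P = 0.
Proof.
move=> curve; apply/eqP/negP => /negP P0.
pose Q := P \mPo [tuple 'X_i + (y0 i)%:MP | i < N].
have QE z : Q.@[z] = P.@[fun i => y0 i + z i].
  rewrite comp_mpoly_meval; apply: meval_eq => i.
  by rewrite tnth_mktuple mevalD mevalXU mevalC addrC.
have Q0 : Q != 0.
  have [v] := mpoly_nonroot char0 P0; apply: contra_neq => Q0.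
  have := QE (fun i => v i - y0 i); rewrite Q0 meval0 => ->.
  by apply: meval_eq => i; rewrite addrC subrK.
pose e := mdeg (mlast Q); pose L := pihomog mdeg e Q.
have le_e m : m \in msupp Q -> (e <= mdeg m)%N.
  by move=> /mlast_lemc/lemc_mdeg.
have L0 : L != 0.
  have L1 m0 : mdeg m0 = e -> L@_m0 = Q@_m0.
    move=> m0e; rewrite [in RHS](mpolyE Q) (bigID (fun m => mdeg m == e)) /= raddfD /= -pihomogE.
    rewrite [X in _ = _ + X]raddf_sum [X in _ = _ + X]big1 ?addr0 // => m me.
    rewrite /= mcoeffZ mcoeffX; have [mm|] := eqVneq m m0; last by rewrite mulr0.
    by rewrite mm m0e eqxx in me.
  apply: contraTneq (mlast_supp Q0) => L0.
  by rewrite mcoeff_msupp negbK -L1 // L0 mcoeff0.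
have [w Lw] := mpoly_nonroot char0 L0.
have [gam [gam0 gam1 Pgam]] := curve w.
pose rho i := drop_poly 1 (gam i).
have rho0 i : (rho i).[0] = w i by rewrite horner_coef0 coef_drop_poly gam1.
have gamE i t : (gam i).[t] = y0 i + t * (rho i).[t].
  rewrite -[in LHS](poly_take_drop 1 (gam i)) !hornerE; congr (_ + _).
    by rewrite -gam0 horner_poly big_ord1 mulr1.
  by rewrite mulrC.
(* [S] is [Q] along the curve, divided by the [e]-th power of the parameter *)
pose S := \sum_(m <- msupp Q) (Q@_m)%:P * 'X^(mdeg m - e) * \prod_i rho i ^+ m i.
have SX : 'X^e * S = 0.
  apply: (poly_fun_eq0 char0) => t.
  rewrite -[RHS](Pgam t) (meval_eq _ (fun i => gamE i t)) -[RHS]QE mevalE.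
  rewrite hornerM horner_sum mulr_sumr big_seq [RHS]big_seq.
  apply: eq_bigr => m /le_e em; rewrite !hornerM !hornerXn hornerC.
  rewrite horner_prod -mulrA mulrCA mulrA -mulrA [X in _ * X]mulrA -exprD subnKC //; congr (_ * _).
  rewrite mdegE -prodrXr -big_split /=; apply: eq_bigr => i _.
  by rewrite horner_exp exprMn.
have S0 : S = 0.
  by apply/eqP; move/eqP: SX; rewrite mulf_eq0 expf_eq0 polyX_eq0 andbF.
case/negP: Lw; rewrite /L pihomogE raddf_sum /=; apply/eqP.
transitivity S.[0]; last by rewrite S0 horner0.
rewrite /S horner_sum [RHS](bigID (fun m => mdeg m == e)) /= -[LHS]addr0.
congr (_ + _); last first.
  rewrite big_seq_cond big1 // => m /andP[/le_e em me].
  rewrite !hornerM hornerXn expr0n subn_eq0 leqNgt ltn_neqAle eq_sym me em.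
  by rewrite mulr0 mul0r.
apply: eq_bigr => m /eqP me; rewrite mevalZ mevalX me subnn expr0 mulr1 hornerM hornerC.
by rewrite horner_prod; congr (_ * _); apply: eq_bigr => i _; rewrite horner_exp rho0.
Qed.

End Curve.

(** * The differential of the Pfaffian *)

Section DerivedPfaffian.
Variables (R : comNzRingType) (T : Type) (f : T -> T -> R).

(** The derivative of [pfl f] in the direction [g], by the product rule. *)
Fixpoint dpfl (g : T -> T -> R) n (l : seq T) : R :=
  if n is n'.+1 then
    if l is a :: l' then
      altsum (fun b r => g a b * pfl f n' r + f a b * dpfl g n' r) l'
    else 0
  else 0.

Lemma dpfl_linear c g h n l :
  dpfl (fun a b => c * g a b + h a b) n l = c * dpfl g n l + dpfl h n l.
Proof.
elim: n l => [|n IHn] [|a l] /=; rewrite ?mulr0 ?addr0 //.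
rewrite -altsumMl -altsumD; apply: eq_altsum => b r _; rewrite IHn; ring.
Qed.

(** The pencil [f + t g] has Pfaffian [pfl f + t (dpfl f g) + O(t^2)]. *)
Lemma pfl_pencil g n l :
  let p := pfl (fun a b => (f a b)%:P + 'X * (g a b)%:P) n l in
  p`_0 = pfl f n l /\ p`_1 = dpfl g n l.
Proof.
have coef_altsum i (h : T -> seq T -> {poly R}) s :
    (altsum h s)`_i = altsum (fun b r => (h b r)`_i) s.
  elim: s h => [|b s IHs] h /=; first by rewrite coef0.
  by rewrite coefB IHs.
elim: n l => [|n IHn] l /=; first by rewrite !coef1.
case: l => [|a l]; first by rewrite !coef0.
rewrite !coef_altsum; split; apply: eq_altsum => b r _.
  by rewrite mulrDl -mulrA coefD coefCM coefXM addr0 (IHn r).1.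
rewrite mulrDl -mulrA coefD coefCM coefXM /= coefCM (IHn r).1 (IHn r).2.
by rewrite addrC.
Qed.

End DerivedPfaffian.

(** * Forms and linear Pfaffians *)

Section Forms.
Variables (k : fieldType) (n d : nat).

Definition nforms := #|{: form_monom n d}|.
Definition form_mon (i : 'I_nforms) : 'X_{1..n} := val (val (enum_val i)).

Lemma mdeg_form_mon i : mdeg (form_mon i) = d.
Proof. exact: eqP (valP (enum_val i)). Qed.

Lemma form_mon_inj : injective form_mon.
Proof. by move=> i j /val_inj/val_inj/enum_val_inj. Qed.

Lemma form_mon_surj m : mdeg m = d -> exists i, form_mon i = m.
Proof.
move=> md; have mb : (mdeg m < d.+1)%N by rewrite md.
have mm : (fun m : 'X_{1..n < d.+1} => mdeg m == d) (BMultinom mb) by rewrite /= md.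
by exists (enum_rank (Sub (BMultinom mb) mm : form_monom n d)); rewrite /form_mon enum_rankK.
Qed.

Lemma form_coefE (F : dhomog n k d) i : form_coef F i = (F : {mpoly k[n]})@_(form_mon i).
Proof. by []. Qed.

Definition form_of (y : 'I_nforms -> k) : {mpoly k[n]} := \sum_i y i *: 'X_[form_mon i].

Lemma form_of_homog y : form_of y \is d.-homog.
Proof. by apply: rpred_sum => i _; rewrite dhomogZ // dhomogX; apply/eqP/mdeg_form_mon. Qed.

Lemma mcoeff_form_of y i : (form_of y)@_(form_mon i) = y i.
Proof.
rewrite raddf_sum (bigD1 i) //= mcoeffZ mcoeffX eqxx mulr1 big1 ?addr0 // => j ji.
by rewrite mcoeffZ mcoeffX (inj_eq form_mon_inj) (negPf ji) mulr0.
Qed.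

Lemma eq_forms (F G : {mpoly k[n]}) : F \is d.-homog -> G \is d.-homog ->
  (forall i, F@_(form_mon i) = G@_(form_mon i)) -> F = G.
Proof.
move=> hF hG FG; apply/mpolyP => m; have [md|md] := eqVneq (mdeg m) d.
  by have [i <-] := form_mon_surj md.
by rewrite !(dhomog_nemf_coeff _ md).
Qed.

Lemma linear_formE (p : {mpoly k[n]}) : p \is 1.-homog ->
  p = \sum_i p@_U_(i) *: 'X_i.
Proof.
move=> hp; apply/mpolyP => m; have [/eqP/mdeg1P[i /eqP->]|m1] := eqVneq (mdeg m) 1%N.
  rewrite raddf_sum (bigD1 i) //= mcoeffZ mcoeffX eqxx mulr1 big1 ?addr0 // => j ji.
  by rewrite mcoeffZ mcoeffX eq_mnm1 (negPf ji) mulr0.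
rewrite (dhomog_nemf_coeff hp m1) raddf_sum big1 // => i _.
rewrite /= mcoeffZ mcoeffX; have [im|] := eqVneq U_(i)%MM m; last by rewrite mulr0.
by rewrite -im mdeg1 in m1.
Qed.

End Forms.

Lemma pfaffian_map (R S : comNzRingType) (phi : {rmorphism R -> S}) n (A : 'M[R]_(2 * n)) :
  phi (pfaffian A) = pfaffian (map_mx phi A).
Proof.
rewrite rmorph_sum; apply: eq_bigr => s _; rewrite rmorphM rmorph_sign rmorph_prod.
by congr (_ * _); apply: eq_bigr => i _; rewrite mxE.
Qed.

Lemma pfaffian_homog (R : comNzRingType) n d (A : 'M[{mpoly R[n]}]_(2 * d)) :
  (forall i j, A i j \is 1.-homog) -> pfaffian A \is d.-homog.
Proof.
move=> hA; apply: rpred_sum => s _.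
have -> : (-1) ^+ s = ((-1) ^+ s)%:MP :> {mpoly R[n]} by rewrite rmorphXn rmorphN1.
rewrite mul_mpolyC dhomogZ //.
have H (r : seq 'I_d) : \prod_(i <- r) A (s (pf_fst i)) (s (pf_snd i)) \is (size r).-homog.
  elim: r => [|i r IHr]; first by rewrite big_nil dhomog1.
  by rewrite big_cons; apply: (@dhomogM _ _ _ 1 _ (size r)).
by have := H (enum 'I_d); rewrite size_enum_ord big_enum.
Qed.

Section LinearMatrices.
Variables (n d : nat).

Definition linear_matrix (R : comNzRingType) (C : 'I_n -> 'M[R]_(2 * d)) :
  'M[{mpoly R[n]}]_(2 * d) := \sum_i 'X_i *: map_mx (@mpolyC n R) (C i).

Lemma linear_matrixE (R : comNzRingType) (C : 'I_n -> 'M[R]_(2 * d)) a b :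
  linear_matrix C a b = \sum_i C i a b *: 'X_i.
Proof.
rewrite summxE; apply: eq_bigr => i _.
by rewrite mxE mxE mulrC mul_mpolyC.
Qed.

Lemma map_linear_matrix (R S : comNzRingType) (phi : {rmorphism R -> S}) C :
  map_mx (map_mpoly phi) (linear_matrix C) = linear_matrix (fun i => map_mx phi (C i)).
Proof.
apply/matrixP => a b; rewrite mxE !linear_matrixE rmorph_sum; apply: eq_bigr => i _ /=.
by rewrite map_mpolyZ map_mpolyX mxE.
Qed.

Lemma linear_matrix_congr (R : comNzRingType) (P : 'M[R]_(2 * d)) C :
  map_mx (@mpolyC n R) P *m linear_matrix C *m (map_mx (@mpolyC n R) P)^T =
  linear_matrix (fun i => P *m C i *m P^T).
Proof.
rewrite mulmx_sumr mulmx_suml; apply: eq_bigr => i _.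
by rewrite -scalemxAr -scalemxAl !map_mxM /= map_trmx.
Qed.

Lemma tr_linear_matrix (R : comNzRingType) C : (forall i, (C i)^T = - C i) ->
  (linear_matrix C)^T = - linear_matrix (R := R) C.
Proof.
move=> Ct; apply/matrixP => a b; rewrite mxE [RHS]mxE !linear_matrixE -sumrN.
apply: eq_bigr => i _; rewrite -scaleNr; congr (_ *: _).
by have /matrixP/(_ a b) := Ct i; rewrite !mxE.
Qed.

End LinearMatrices.

(** A matrix [G] with parameters in its coefficients defines a polynomial map: a
    point [x] of the parameter space goes to the coefficients of the Pfaffian of the
    matrix obtained by specializing the parameters to [x]. *)
Section PfaffianCoefficients.
Variables (k : fieldType) (n d m : nat).
Variable G : 'M[{mpoly {mpoly k[m]}[n]}]_(2 * d).

Definition pf_coef (i : 'I_(nforms n d)) : {mpoly k[m]} := (pfaffian G)@_(form_mon i).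

Definition specialize (x : 'I_m -> k) : 'M[{mpoly k[n]}]_(2 * d) :=
  map_mx (map_mpoly (meval x)) G.

Lemma pf_coefP x i : (pf_coef i).@[x] = (pfaffian (specialize x))@_(form_mon i).
Proof. by rewrite /specialize -pfaffian_map mcoeff_map_mpoly. Qed.

End PfaffianCoefficients.

Section GenericLinearMatrix.
Variables (k : fieldType) (n d : nat).
Hypothesis char0 : [pchar k] =i pred0.

Definition skew_linear (M : 'M[{mpoly k[n]}]_(2 * d)) :=
  M^T = - M /\ forall a b, M a b \is 1.-homog.

Lemma linear_matrix_skew_linear (C : 'I_n -> 'M[k]_(2 * d)) :
  (forall i, (C i)^T = - C i) -> skew_linear (linear_matrix C).
Proof.
move=> Ct; split=> [|a b]; first exact: tr_linear_matrix.
rewrite linear_matrixE; apply: rpred_sum => i _.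
by rewrite dhomogZ // dhomogX; apply/eqP/mdeg1.
Qed.

Lemma skew_linearP M : skew_linear M ->
  exists2 C : 'I_n -> 'M[k]_(2 * d), M = linear_matrix C & forall i, (C i)^T = - C i.
Proof.
move=> [MT M1]; exists (fun i => map_mx (mcoeff U_(i)%MM) M).
  apply/matrixP => a b; rewrite linear_matrixE {1}(linear_formE (M1 a b)).
  by apply: eq_bigr => i _; rewrite mxE.
move=> i; apply/matrixP => a b; rewrite !mxE.
by have /matrixP/(_ a b) := MT; rewrite !mxE => ->; rewrite mcoeffN.
Qed.

Definition coord := ('I_n * 'I_(2 * d) * 'I_(2 * d))%type.

(** The parameter space consists of arbitrary, not only skew, matrices: a matrix is
    made skew by subtracting its transpose, and every skew matrix arises from half
    of itself. *)
Definition generic_skew : 'M[{mpoly {mpoly k[#|{: coord}|]}[n]}]_(2 * d) :=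
  linear_matrix (fun i => \matrix_(a, b)
    ('X_(enum_rank (i, a, b)) - 'X_(enum_rank (i, b, a)))).

Lemma specialize_generic_skew x : specialize generic_skew x =
  linear_matrix (fun i => \matrix_(a, b)
    (x (enum_rank (i, a, b)) - x (enum_rank (i, b, a)))).
Proof.
rewrite /specialize map_linear_matrix; apply: eq_bigr => i _; congr (_ *: map_mx _ _).
by apply/matrixP => a b; rewrite !mxE rmorphB /= !mevalXU.
Qed.

Lemma specialize_skew_linear x : skew_linear (specialize generic_skew x).
Proof.
rewrite specialize_generic_skew; apply: linear_matrix_skew_linear => i.
by apply/matrixP => a b; rewrite !mxE opprB.
Qed.

Lemma skew_linear_specialize M : skew_linear M ->
  exists x, M = specialize generic_skew x.
Proof.
case/skew_linearP=> C -> Ct.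
exists (fun j => let: (i, a, b) := enum_val j in 2%:R^-1 * C i a b).
rewrite specialize_generic_skew; apply: eq_bigr => i _; congr (_ *: map_mx _ _).
apply/matrixP => a b; rewrite mxE !enum_rankK.
have -> : C i b a = - C i a b by have /matrixP/(_ a b) := Ct i; rewrite !mxE.
rewrite mulrN opprK -mulr2n -mulrnAl -mulr_natr mulVf ?mul1r //.
by rewrite (pcharf0P k).1.
Qed.

End GenericLinearMatrix.

Lemma horner_mcoeff (k : fieldType) n (m : 'X_{1..n}) (p : {poly {mpoly k[n]}}) t :
  (map_poly (mcoeff m) p).[t] = p.[t%:MP]@_m.
Proof.
rewrite (horner_coef_wide _ (size_poly _ _)) horner_coef raddf_sum.
apply: eq_bigr => j _ /=; have -> : t%:MP_[n] ^+ j = (t ^+ j)%:MP by rewrite rmorphXn.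
by rewrite coef_map /= [in RHS]mulrC mcoeffCM mulrC.
Qed.

Section TangentSpace.
Variables (k : fieldType) (n d : nat) (f : nat -> nat -> {mpoly k[n]}).

(** The image of the differential, at the matrix of [f], of the map from skew
    matrices of linear forms to their Pfaffians. *)
Definition tangent (w : {mpoly k[n]}) : Prop :=
  exists g : nat -> nat -> {mpoly k[n]},
    [/\ forall a b, g a b = - g b a, forall a b, g a b \is 1.-homog
      & w = dpfl f g d (iota 0 (2 * d))].

Lemma tangent_comb c v w : tangent v -> tangent w -> tangent (c *: v + w).
Proof.
move=> [g [gC gh ->]] [h [hC hh ->]]; exists (fun a b => c%:MP * g a b + h a b).
split=> [a b|a b|]; last by rewrite dpfl_linear mul_mpolyC.
  by rewrite gC hC mulrN opprD.
by rewrite mul_mpolyC dhomogD // dhomogZ.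
Qed.

Lemma tangent0 : tangent 0.
Proof.
exists (fun _ _ => 0); split=> [_ _|_ _|]; rewrite ?oppr0 ?dhomog0 //.
have -> : dpfl f (fun _ _ => 0) d (iota 0 (2 * d)) =
    dpfl f (fun _ _ => -1 * 0 + 0) d (iota 0 (2 * d)) by rewrite mulr0 addr0.
by rewrite dpfl_linear mulN1r addNr.
Qed.

Lemma tangentZ c w : tangent w -> tangent (c *: w).
Proof. by move=> tw; rewrite -[_ *: _]addr0; apply: tangent_comb tangent0. Qed.

End TangentSpace.

Section Dominance.
Variables (k : closedFieldType) (d : nat).
Hypothesis char0 : [pchar k] =i pred0.
Variable f : nat -> nat -> {mpoly k[5]}.
Hypothesis fskew : forall a b, f a b = - f b a.
Hypothesis f1 : forall a b, f a b \is 1.-homog.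
Hypothesis tangent_full : forall w, w \is d.-homog -> tangent d f w.

(** If the differential of the Pfaffian at [f] is surjective onto forms, then no
    nonzero polynomial vanishes on the image of the Pfaffian map, because this image
    contains curves in all directions; hence the image contains an open subset. *)
Lemma dominant_open :
  exists2 P : {mpoly k[nforms 5 d]}, P != 0 & forall y, P.@[y] != 0 ->
   exists2 M : 'M[{mpoly k[5]}]_(2 * d), skew_linear M & pfaffian M = form_of y.
Proof.
have [P P0 [imP|imP]] := image_generic (pf_coef (generic_skew k 5 d)).
  exists P => // y /imP[x xy]; exists (specialize (generic_skew k 5 d) x).
    exact: specialize_skew_linear.
  have [_ h] := specialize_skew_linear (k := k) (n := 5) (d := d) x.
  apply: (eq_forms (pfaffian_homog h)) (form_of_homog y) _ => i.
  by rewrite mcoeff_form_of xy pf_coefP.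
case/eqP: P0; pose l := iota 0 (2 * d).
apply: (mpoly_curve char0 (y0 := fun i => (pfl f d l)@_(form_mon i))) => w.
have [g [gC g1 gw]] := tangent_full (form_of_homog w).
pose Gam := pfl (fun a b => (f a b)%:P + 'X * (g a b)%:P) d l.
have [Gam0 Gam1] := pfl_pencil f g d l; rewrite -/Gam in Gam0 Gam1.
exists (fun i => map_poly (mcoeff (form_mon i)) Gam); split=> [i|i|t].
- by rewrite coef_map /= Gam0.
- by rewrite coef_map /= Gam1 -gw mcoeff_form_of.
pose M := \matrix_(a < 2 * d, b < 2 * d) (f a b + t *: g a b).
have MS : skew_linear M.
  split=> [|a b]; last by rewrite mxE dhomogD // dhomogZ.
  by apply/matrixP => a b; rewrite !mxE fskew gC scalerN -opprD.
have [x Mx] := skew_linear_specialize char0 MS.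
rewrite -[RHS](imP x); apply: meval_eq => i; rewrite pf_coefP -Mx horner_mcoeff.
congr (_@__); rewrite (pfaffian_pfl (fun a b => f a b + t *: g a b) _ id) /mkseq map_id.
transitivity (horner_eval t%:MP_[5] Gam) => //; rewrite rmorph_pfl.
by apply: eq_pfl => a b; rewrite /= /horner_eval !hornerE mul_mpolyC.
Qed.

End Dominance.

Section GeneralForms.
Variables (k : fieldType) (d : nat).
Hypothesis char0 : [pchar k] =i pred0.

Lemma nforms_gt0 : (0 < nforms 5 d)%N.
Proof.
have [|i _] := @form_mon_surj 5 d (U_(ord0) *+ d)%MM.
  by rewrite mdegMn mdeg1 mul1n.
exact: leq_ltn_trans (ltn_ord i).
Qed.

Lemma form_of_neq0 n e (y : 'I_(nforms n e) -> k) i : y i != 0 -> form_of y != 0.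
Proof. by rewrite -mcoeff_form_of; apply: contra_neq => ->; rewrite mcoeff0. Qed.

Lemma pihomog_neq0 N (P : {mpoly k[N]}) : P != 0 -> exists e, pihomog mdeg e P != 0.
Proof.
move=> P0; exists (mdeg (mlead P)); apply: contra_neq P0 => L0; have [//|P0] := eqVneq P 0.
have := congr1 (fun q => q@_(mlead P)) L0.
rewrite /= pihomogE raddf_sum /= mcoeff0 -big_filter.
rewrite (bigD1_seq (mlead P)) ?filter_uniq ?msupp_uniq ?mem_filter ?eqxx ?mlead_supp //=.
rewrite mcoeffZ mcoeffX eqxx mulr1 big1 ?addr0 => [c0|m /negPf mm]; last first.
  by rewrite mcoeffZ mcoeffX mm mulr0.
by apply/eqP; rewrite -mleadc_eq0 c0.
Qed.

(** The homogeneous parts of [P] at [y] are the coefficients of the polynomial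
    [P (t y)] in [t]. *)
Lemma scaled_nonroot N (P : {mpoly k[N]}) e (y : 'I_N -> k) :
  (pihomog mdeg e P).@[y] != 0 ->
  exists2 t : k, t != 0 & P.@[fun i => t * y i] != 0.
Proof.
move=> Py; pose q : {poly k} := \sum_(m <- msupp P) (P@_m * 'X_[m].@[y]) *: 'X^(mdeg m).
have qe : q`_e = (pihomog mdeg e P).@[y].
  rewrite pihomogE raddf_sum coef_sum [RHS]big_mkcond; apply: eq_bigr => m _ /=.
  rewrite coefZ coefXn mevalZ eq_sym; by case: eqP => _; rewrite ?mulr1 ?mulr0.
have q0 : 'X * q != 0.
  rewrite mulf_neq0 ?polyX_eq0 //; apply: contra_neq Py => q0.
  by rewrite -qe q0 coef0.
have [i] := poly_nonroot char0 q0; rewrite hornerM hornerX mulf_eq0 negb_or => /andP[i0 qi].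
exists i%:R => //; rewrite mevalE; move: qi; rewrite horner_sum; congr (_ != _).
apply: eq_bigr => m _; rewrite hornerZ hornerXn mevalX -mulrA; congr (_ * _).
rewrite mdegE -prodrXr -big_split /=; apply: eq_bigr => j _.
by rewrite exprMn mulrC.
Qed.

(** Linear Pfaffians form a cone, so that the open set may be cut out by a single
    homogeneous part of [P]. *)
Lemma general_of_open (P : {mpoly k[nforms 5 d]}) : P != 0 ->
  (forall y, P.@[y] != 0 ->
     exists2 M : 'M[{mpoly k[5]}]_(2 * d), skew_linear M & pfaffian M = form_of y) ->
  general_hypersurface (fun F : dhomog 5 k d => linear_pfaffian F).
Proof.
move=> P0 PM; have [e Pe] := pihomog_neq0 P0.
pose U (F : dhomog 5 k d) := F != 0 /\ (pihomog mdeg e P).@[form_coef F] != 0.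
exists U; split.
- exists (eq (pihomog mdeg e P)); split=> [_ <-|F]; first by exists e; apply: pihomogP.
  by split=> [[F0 Fe]|[F0 [_ <- Fe]]]; split=> //; exists (pihomog mdeg e P).
- pose i0 := Ordinal nforms_gt0.
  have X0 : 'X_i0 != 0 :> {mpoly k[nforms 5 d]}.
    by rewrite -msize_poly_eq0 msizeX.
  have [y] := mpoly_nonroot char0 (mulf_neq0 Pe X0).
  rewrite mevalM mevalXU mulf_eq0 negb_or => /andP[Py yi].
  exists (DHomog (form_of_homog y)); split; last first.
    by move: Py; congr (_ != _); apply: meval_eq => i; rewrite form_coefE mcoeff_form_of.
  by rewrite -val_eqE /=; apply: form_of_neq0 yi.
move=> F [_ Fe]; have [t t0 /PM[M [MT M1] pfM]] := scaled_nonroot Fe.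
exists M; split=> //; exists t => //; rewrite pfM.
apply: (eq_forms (form_of_homog _)) => [|i].
  by rewrite dhomogZ // dhomog_is_dhomog.
by rewrite mcoeff_form_of mcoeffZ.
Qed.

End GeneralForms.

(** * Integer computations with Pfaffians *)

Module Z := BinInt.Z.
Local Notation Z := BinNums.Z.
Local Notation Z0 := BinNums.Z0.
Local Notation Z1 := (BinNums.Zpos BinNums.xH).
Local Notation Zm1 := (BinNums.Zneg BinNums.xH).

Section SparsePolynomials.

(** Integer polynomials are lists of terms, a monomial being the list of its
    exponents: unlike [{mpoly k[5]}], this computes. *)
Definition zpoly := seq (seq nat * Z).

Fixpoint zaddt (m : seq nat) (c : Z) (p : zpoly) : zpoly :=
  if p is (m', c') :: p' then
    if m == m' then
      let c'' := Z.add c c' in if Z.eqb c'' Z0 then p' else (m, c'') :: p'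
    else (m', c') :: zaddt m c p'
  else [:: (m, c)].

Definition zcomb (a : Z) (p q : zpoly) : zpoly :=
  foldr (fun t acc => zaddt t.1 (Z.mul a t.2) acc) q p.

Definition zmulx (x : nat) (p : zpoly) : zpoly :=
  [seq (incr_nth t.1 x, t.2) | t <- p].

Fixpoint zcoef (m : seq nat) (p : zpoly) : Z :=
  if p is (m', c) :: p' then if m == m' then c else zcoef m p' else Z0.

Fixpoint zaltsum (g : nat -> seq nat -> zpoly) (l : seq nat) : zpoly :=
  if l is b :: l' then
    zcomb Zm1 (zaltsum (fun c r => g c (b :: r)) l') (g b l')
  else [::].

(** A matrix entry is zero or a variable with a sign, [true] meaning minus. *)
Definition entry := option (bool * nat).

(** The second factor is a thunk, so that a zero entry cuts off the recursion into
    the corresponding minor. *)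
Definition zmule (e : entry) (p : unit -> zpoly) : zpoly :=
  if e is Some (s, x) then zcomb (if s then Zm1 else Z1) (zmulx x (p tt)) [::]
  else [::].

Variables f g : nat -> nat -> entry.

Fixpoint zpfl n (l : seq nat) : zpoly :=
  if n is n'.+1 then
    if l is a :: l' then zaltsum (fun b r => zmule (f a b) (fun _ => zpfl n' r)) l'
    else [::]
  else [:: ([:: 0; 0; 0; 0; 0]%N, Z1)].

Fixpoint zdpfl n (l : seq nat) : zpoly :=
  if n is n'.+1 then
    if l is a :: l' then
      zaltsum (fun b r => zcomb Z1 (zmule (g a b) (fun _ => zpfl n' r))
                                  (zmule (f a b) (fun _ => zdpfl n' r))) l'
    else [::]
  else [::].

End SparsePolynomials.

Definition position_entry (pos : nat -> nat -> option nat) a b : entry :=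
  if (a < b)%N then omap (pair false) (pos a b)
  else if (b < a)%N then omap (pair true) (pos b a) else None.

Section Evaluation.
Variable k : fieldType.

Definition zr (z : Z) : k := (int_of_Z z)%:~R.

Lemma zrD a b : zr (Z.add a b) = zr a + zr b.
Proof. by rewrite /zr -intrD -rmorphD. Qed.

Lemma zrM a b : zr (Z.mul a b) = zr a * zr b.
Proof. by rewrite /zr -intrM -rmorphM. Qed.

Definition mnm (s : seq nat) : 'X_{1..5} := [multinom nth 0%N s i | i < 5].

Definition ev (p : zpoly) : {mpoly k[5]} := \sum_(t <- p) zr t.2 *: 'X_[mnm t.1].

Definition ev_entry (e : entry) : {mpoly k[5]} :=
  if e is Some (s, x) then (-1) ^+ s *: 'X_[mnm (incr_nth [::] x)] else 0.

Lemma ev_addt m c p : ev (zaddt m c p) = zr c *: 'X_[mnm m] + ev p.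
Proof.
elim: p => [|[m' c'] p IHp] /=; first by rewrite /ev big_seq1 big_nil addr0.
case: eqVneq => [<-|_]; last by rewrite /ev !big_cons -/(ev _) IHp addrCA.
rewrite /ev big_cons /= -/(ev p) addrA -scalerDl -zrD.
case: Z.eqb_spec => [->|_]; first by rewrite /zr /= scale0r add0r.
by rewrite big_cons.
Qed.

Lemma ev_comb a p q : ev (zcomb a p q) = zr a *: ev p + ev q.
Proof.
elim: p => [|[m c] p IHp]; first by rewrite {2}/ev big_nil scaler0 add0r.
rewrite [zcomb _ _ _]/= ev_addt IHp /= /ev big_cons /= scalerDr addrA.
by rewrite zrM scalerA.
Qed.

Lemma mnm_incr s x : mnm (incr_nth s x) = (mnm (incr_nth [::] x) + mnm s)%MM.
Proof. by apply/mnmP => i; rewrite mnmDE !mnmE !nth_incr_nth nth_nil addn0. Qed.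

Lemma ev_mulx x p : ev (zmulx x p) = 'X_[mnm (incr_nth [::] x)] * ev p.
Proof.
rewrite /ev big_map mulr_sumr; apply: eq_bigr => -[m c] _ /=.
by rewrite mnm_incr mpolyXD scalerAr.
Qed.

Lemma ev_mule e p : ev (zmule e p) = ev_entry e * ev (p tt).
Proof.
case: e => [[s x]|]; last by rewrite /ev big_nil mul0r.
rewrite /zmule ev_comb ev_mulx [ev [::]]/ev big_nil addr0 /= scalerAl.
by case: s.
Qed.

Lemma ev_altsum g l : ev (zaltsum g l) = altsum (fun b r => ev (g b r)) l.
Proof.
elim: l g => [|b l IHl] g /=; first by rewrite /ev big_nil.
by rewrite ev_comb IHl /zr /= scaleN1r addrC.
Qed.

Variables f g : nat -> nat -> entry.

Lemma ev_pfl n l : ev (zpfl f n l) = pfl (fun a b => ev_entry (f a b)) n l.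
Proof.
have ev1 : ev [:: ([:: 0; 0; 0; 0; 0]%N, Z1)] = 1.
  rewrite /ev big_seq1 /zr scale1r -[RHS]mpolyX0; congr 'X_[_].
  by apply/mnmP => i; rewrite !mnmE; case: i => -[|[|[|[|[]]]]].
elim: n l => [|n IHn] [|a l] //=; first by rewrite /ev big_nil.
by rewrite ev_altsum; apply: eq_altsum => b r _; rewrite ev_mule IHn.
Qed.

Lemma ev_dpfl n l : ev (zdpfl f g n l) =
  dpfl (fun a b => ev_entry (f a b)) (fun a b => ev_entry (g a b)) n l.
Proof.
elim: n l => [|n IHn] [|a l] //=; rewrite ?ev_altsum /ev ?big_nil //.
apply: eq_altsum => b r _; rewrite -/(ev _) ev_comb !ev_mule IHn ev_pfl.
by rewrite /zr scale1r.
Qed.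

Lemma ev_entry_skew pos a b :
  ev_entry (position_entry pos a b) = - ev_entry (position_entry pos b a).
Proof.
rewrite /position_entry; case: ltngtP => _.
- by case: (pos a b) => [x|] /=; rewrite ?oppr0 // expr1 scaleN1r scale1r opprK.
- by case: (pos b a) => [x|] /=; rewrite ?oppr0 // expr1 scaleN1r scale1r.
by rewrite oppr0.
Qed.

Lemma ev_entry_homog pos a b : (forall a b x, pos a b = Some x -> (x < 5)%N) ->
  ev_entry (position_entry pos a b) \is 1.-homog.
Proof.
move=> pos5; have H s x : (x < 5)%N -> ev_entry (Some (s, x)) \is 1.-homog.
  move=> x5; apply: dhomogZ; rewrite dhomogX.
  suff -> : mnm (incr_nth [::] x) = U_(Ordinal x5)%MM by apply/eqP/mdeg1.
  by apply/mnmP => i; rewrite mnm1E mnmE nth_incr_nth nth_nil addn0.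
rewrite /position_entry; case: ltngtP => _ /=; last exact: dhomog0.
  by case E: (pos a b) => [x|]; [exact: (H false x (pos5 _ _ _ E)) | exact: dhomog0].
by case E: (pos b a) => [x|]; [exact: (H true x (pos5 _ _ _ E)) | exact: dhomog0].
Qed.

End Evaluation.

(** * Spanning all forms by elimination *)

(** A table lists, for each of the five variables, the positions [(a, b)] with
    [a < b] at which the skew matrix has that variable as its entry. *)
Definition table_pos (tab : seq (seq (nat * nat))) (a b : nat) : option nat :=
  let x := find (fun s => (a, b) \in s) tab in
  if (x < size tab)%N then Some x else None.

Definition unit_pos (x i j a b : nat) : option nat :=
  if (a == i) && (b == j) then Some x else None.

(** Matrices with a single variable at a single position above the diagonal, made
    skew, span all skew matrices of linear forms; hence these polynomials span the
    image of the differential. *)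
Definition generators d tab : seq zpoly :=
  [seq zdpfl (position_entry (table_pos tab)) (position_entry (unit_pos t.1 t.2.1 t.2.2))
     d (iota 0 (2 * d)) | t <- [seq (x, ij) | x <- iota 0 5,
        ij <- [seq (i, j) | j <- iota 0 (2 * d), i <- iota 0 j]]].

(** Fraction-free elimination from [p] of the pivot monomial [r.1] of the row [r].
    Whatever the multipliers, the result is a combination of [p] and the row, which
    is all that correctness needs; dividing by the gcd keeps the integers small. *)
Definition zreduce (r : seq nat * zpoly) (p : zpoly) : zpoly :=
  let c := zcoef r.1 p in
  if Z.eqb c Z0 then p else
    let e := zcoef r.1 r.2 in let h := Z.gcd c e in
    zcomb (Z.opp (Z.div c h)) r.2 (zcomb (Z.div e h) p [::]).

(** As in Gauss-Jordan elimination the new pivot is also removed from the old rows,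
    so that in the end each row is a multiple of a single monomial if the rows span
    all forms. *)
Definition zinsert (rows : seq (seq nat * zpoly)) (p : zpoly) :=
  let p' := foldl (fun q r => zreduce r q) p rows in
  if p' is (m, _) :: _ then
    (m, p') :: [seq (r.1, zreduce (m, p') r.2) | r <- rows]
  else rows.

Fixpoint exponents (n d : nat) : seq (seq nat) :=
  if n is n'.+1 then
    [seq a :: s | a <- iota 0 d.+1, s <- exponents n' (d - a)%N]
  else if d == 0%N then [:: [::]] else [::].

Definition spans d (gs : seq zpoly) : bool :=
  let rows := foldl zinsert [::] gs in
  all (fun m => has (fun r => if r.2 is [:: (m', c)] then
                                (m == m') && ~~ Z.eqb c Z0 else false) rows)
    (exponents 5 d).

Section Spanning.
Variable k : fieldType.
Hypothesis char0 : [pchar k] =i pred0.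
Variables (d : nat) (tab : seq (seq (nat * nat))).

Definition table_form a b : {mpoly k[5]} :=
  ev_entry k (position_entry (table_pos tab) a b).

Local Notation tangent := (tangent d table_form).

Lemma tangent_generator p : p \in generators d tab -> tangent (ev k p).
Proof.
case/mapP=> -[x [i j]] /allpairsP[[x' ij] /= [x5 _ [-> _]]] ->.
exists (fun a b => ev_entry k (position_entry (unit_pos x' i j) a b)).
split=> [a b|a b|]; first exact: ev_entry_skew; last exact: ev_dpfl.
apply: ev_entry_homog => {}a {}b y; rewrite /unit_pos; case: ifP => // _ [<-].
by rewrite -[_ :: _]/(iota 0 5) mem_iota in x5.
Qed.

Lemma tangent_reduce r p : tangent (ev k r.2) -> tangent (ev k p) ->
  tangent (ev k (zreduce r p)).
Proof.
move=> tr tp; rewrite /zreduce; case: ifP => // _; rewrite !ev_comb.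
apply: tangent_comb => //; apply: tangent_comb => //.
by rewrite /ev big_nil; apply: tangent0.
Qed.

Lemma tangent_rows gs : (forall p, p \in gs -> tangent (ev k p)) ->
  forall r, r \in foldl zinsert [::] gs -> tangent (ev k r.2).
Proof.
have ins rows p : (forall r, r \in rows -> tangent (ev k r.2)) ->
    tangent (ev k p) -> forall r, r \in zinsert rows p -> tangent (ev k r.2).
  move=> trows tp; rewrite /zinsert; set p' := foldl _ _ _.
  have tp' : tangent (ev k p').
    rewrite /p'; elim: rows p tp trows {p'} => //= r rows IHr p tp trows.
    apply: IHr => [|q qr]; last by apply: trows; rewrite inE qr orbT.
    by apply: tangent_reduce => //; apply: trows; rewrite mem_head.
  case: p' tp' => // -[m c] q tp' r; rewrite inE => /predU1P[->//|/mapP[s rs ->]].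
  by apply: tangent_reduce => //; apply: trows.
suff H rows : (forall r, r \in rows -> tangent (ev k r.2)) ->
    (forall p, p \in gs -> tangent (ev k p)) ->
    forall r, r \in foldl zinsert rows gs -> tangent (ev k r.2).
  exact: H.
elim: gs rows => //= p gs IHgs rows trows tgs; apply: IHgs.
  by apply: ins => //; apply: tgs; rewrite mem_head.
by move=> q qg; apply: tgs; rewrite inE qg orbT.
Qed.

Lemma zr_neq0 c : ~~ Z.eqb c Z0 -> zr k c != 0.
Proof.
have natr_neq0 n : n != 0%N -> n%:R != 0 :> k.
  by rewrite (pcharf0P k).1.
move=> /Z.eqb_spec c0; rewrite /zr.
case E: (int_of_Z c) => [n|n]; last by rewrite NegzE mulrNz oppr_eq0 natr_neq0.
apply: natr_neq0; apply/eqP => n0; apply: c0.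
by rewrite -[c]int_of_ZK E n0.
Qed.

Lemma mem_exponents n e (s : seq nat) : size s = n -> sumn s = e -> s \in exponents n e.
Proof.
elim: n e s => [|n IHn] e [|a s] //; first by move=> _ <-.
case=> sn <-; apply/(@allpairsPdep _ (fun=> _)); exists a, s; split=> //.
  by rewrite mem_iota /= add0n ltnS leq_addr.
by apply: IHn; rewrite //= addKn.
Qed.

Lemma tangent_monomial m : spans d (generators d tab) -> mdeg m = d ->
  tangent 'X_[m].
Proof.
move=> /allP/(_ (m : seq nat)) sp md.
have /sp/hasP[[m' q] rq] /= : (m : seq nat) \in exponents 5 d.
  by apply: mem_exponents; rewrite ?size_tuple // -md /mdeg sumnE.
case: q rq => [|[m'' c] [|]] // rq /andP[/eqP mm c0].
have := tangent_rows tangent_generator rq; rewrite /= /ev big_seq1 /=.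
move=> /(tangentZ (zr k c)^-1); rewrite scalerA mulVf ?zr_neq0 // scale1r -mm.
congr (tangent 'X_[_]).
by apply/mnmP => i; rewrite mnmE /= -tnth_nth.
Qed.

End Spanning.

Lemma general_of_spans (k : closedFieldType) d tab : [pchar k] =i pred0 ->
  (size tab <= 5)%N -> spans d (generators d tab) ->
  general_hypersurface (fun F : dhomog 5 k d => linear_pfaffian F).
Proof.
move=> char0 tab5 sp.
have fskew a b : table_form k tab a b = - table_form k tab b a by apply: ev_entry_skew.
have f1 a b : table_form k tab a b \is 1.-homog.
  apply: ev_entry_homog => {}a {}b x; rewrite /table_pos; case: ifP => // xt [<-].
  exact: leq_trans xt tab5.
have full (w : {mpoly k[5]}) : w \is d.-homog -> tangent d (table_form k tab) w.
  move=> /dhomogP hw; rewrite [w]mpolyE big_seq.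
  apply: big_ind => [|v v' tv tv'|m /hw md]; first exact: tangent0.
    by rewrite -[v]scale1r; apply: tangent_comb.
  exact/tangentZ/tangent_monomial.
have [P P0 PM] := dominant_open char0 fskew f1 full.
exact: general_of_open PM.
Qed.

(** In degree [d], each variable occupies [d - 1] pairwise disjoint positions.  This is
    the least that is needed: [x ^ d] lies in the image of the differential only if
    the matrix has rank at least [2 * (d - 1)] at the coordinate point of [x]. *)
Definition tables : seq (seq (seq (nat * nat))) := [::
  [:: [::]; [::]; [::]; [::]; [::]];
  [:: [:: (0, 1)]; [:: (0, 2)]; [:: (0, 3)]; [:: (1, 2)]; [:: (1, 3)]];
  [:: [:: (0, 3); (1, 4)]; [:: (0, 1); (2, 3)]; [:: (0, 4); (3, 5)];
      [:: (0, 5); (2, 4)]; [:: (0, 2); (3, 4)]];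
  [:: [:: (0, 6); (2, 5); (3, 7)]; [:: (0, 1); (3, 5); (6, 7)];
      [:: (0, 3); (2, 6); (4, 7)]; [:: (1, 2); (4, 6); (5, 7)];
      [:: (0, 4); (1, 6); (2, 7)]];
  [:: [:: (0, 2); (3, 6); (4, 8); (7, 9)]; [:: (0, 4); (1, 9); (2, 6); (5, 8)];
      [:: (0, 8); (1, 3); (2, 7); (4, 6)]; [:: (0, 9); (2, 4); (3, 5); (6, 8)];
      [:: (0, 6); (1, 4); (2, 8); (5, 7)]]]%N.

Lemma tables_span : all (fun d => let tab := nth [::] tables d in
  (size tab <= 5)%N && spans d.+1 (generators d.+1 tab)) (iota 0 5).
Proof. by vm_compute. Qed.

(** * Normal form of pencils of skew matrices *)

Section HankelPencil.
Variables (R : comNzRingType) (d : nat).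

(** The skew matrix with blocks [0, H; - H^T, 0], where [H] is the [d * d] Hankel
    matrix of the sequence [h] shifted by [e]. *)
Definition hankel (e : nat) (h : nat -> R) : 'M[R]_(2 * d) :=
  \matrix_(a, b) if (a < d <= b)%N then h (a + b - d + e)%N
                 else if (b < d <= a)%N then - h (a + b - d + e)%N else 0.

Definition krylov (u : 'rV[R]_(2 * d)) (T : 'M[R]_(2 * d)) : 'M[R]_(d, 2 * d) :=
  \matrix_(i < d) iter i (mulmx^~ T) u.

Definition row0 : 'rV[R]_(2 * d) := \row_b (b == 0%N :> nat)%:R.

Lemma widen_subproof : (d <= 2 * d)%N.
Proof. by rewrite leq_pmull. Qed.

(** If this does not vanish, [M0] is invertible and the iterates of the row vector
    [row0] under [M1 *m invmx M0] are independent.  The adjugate replaces the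
    inverse to make it a polynomial in the entries of [M0] and [M1]. *)
Definition nondeg (M0 M1 : 'M[R]_(2 * d)) : R :=
  \det M0 * \det (colsub (widen_ord widen_subproof) (krylov row0 (M1 *m \adj M0))).

End HankelPencil.

Lemma row0_map (R S : comNzRingType) (phi : {rmorphism R -> S}) d :
  map_mx phi (row0 R d) = row0 S d.
Proof. by apply/matrixP => a b; rewrite !mxE rmorph_nat. Qed.

Lemma nondeg_map (R S : comNzRingType) (phi : {rmorphism R -> S}) d
    (M0 M1 : 'M[R]_(2 * d)) :
  phi (nondeg M0 M1) = nondeg (map_mx phi M0) (map_mx phi M1).
Proof.
rewrite rmorphM -!det_map_mx; congr (_ * \det _).
apply/matrixP => i j; rewrite !mxE.
transitivity (map_mx phi (iter i (mulmx^~ (M1 *m \adj M0)) (row0 R d))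
  0 (widen_ord (widen_subproof d) j)); first by rewrite mxE.
congr (fun_of_matrix _ 0 _).
elim: (i : nat) => [|i' IHi] /=; first exact: row0_map.
by rewrite map_mxM /= IHi map_mxM map_mx_adj.
Qed.

Section NormalForm.
Variables (k : fieldType) (d : nat).

(** With the columns in reverse order, this matrix is lower triangular with diagonal
    entries [1] and [-1]. *)
Lemma hankel_unit (h : nat -> k) : (forall m, (m < d)%N -> h m = (m.+1 == d)%:R) ->
  hankel d 0 h \in unitmx.
Proof.
move=> hd; pose A := \matrix_(a, b) hankel d 0 h a (rev_ord b).
have -> : hankel d 0 h = A *m perm_mx (perm (@rev_ord_inj (2 * d))).
  rewrite -[perm _]invgK -col_permE; apply/matrixP => a b; rewrite !mxE.
  suff -> : (perm (@rev_ord_inj (2 * d)))^-1%g b = rev_ord b by rewrite rev_ordK.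
  by apply: (@perm_inj _ (perm (@rev_ord_inj _))); rewrite permKV permE rev_ordK.
have hE (a b : 'I_(2 * d)) : (a <= b)%N ->
    A a b = (if (a < d)%N then 1 else -1) * (a == b)%:R.
  move=> ab; have := ltn_ord a; have := ltn_ord b; rewrite !mxE /= addn0 => bd ad.
  have ab_eq : (d <= a + (2 * d - b.+1))%N ->
      (a == b) = ((a + (2 * d - b.+1) - d).+1 == d).
    by rewrite -val_eqE /= => le; apply/eqP/eqP; lia.
  case: ifP => [/andP[ad' bd']|ad'].
    by rewrite ad' mul1r hd ?ab_eq //; lia.
  case: ifP => [/andP[bd'' ad'']|ad''].
    by rewrite ltnNge ad'' mulN1r hd ?ab_eq //; lia.
  rewrite -val_eqE /= [_ == _](_ : _ = false) ?mulr0 //; apply/eqP; lia.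
rewrite unitmx_mul unitmx_perm andbT unitmxE det_trig.
  rewrite unitfE; apply/prodf_neq0 => a _; rewrite hE // eqxx mulr1.
  by case: ifP; rewrite ?oppr_eq0 oner_eq0.
by apply/is_trig_mxP => a b ab; rewrite hE ?(ltnW ab) // -val_eqE /= ltn_eqF ?mulr0.
Qed.

Hypothesis two_neq0 : 2%:R != 0 :> k.

Lemma self_opp0 (x : k) : x = - x -> x = 0.
Proof.
move/eqP; rewrite -subr_eq0 opprK -mulr2n -mulr_natl mulf_eq0 (negPf two_neq0).
by move/eqP.
Qed.

Variables (M0 M1 : 'M[k]_(2 * d)).
Hypotheses (M0T : M0^T = - M0) (M1T : M1^T = - M1) (M0u : M0 \in unitmx).

Let T := M1 *m invmx M0.

Let mulTM0 : T *m M0 = M1.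
Proof. by rewrite /T mulmxKV. Qed.

Let mulM0T : M0 *m T^T = M1.
Proof. by rewrite -[M0]opprK -M0T mulNmx -trmx_mul mulTM0 M1T opprK. Qed.

Let form (x y : 'rV[k]_(2 * d)) : k := (x *m M0 *m y^T) 0 0.
Let pow (x : 'rV[k]_(2 * d)) i := iter i (mulmx^~ T) x.

Let formC x y : form x y = - form y x.
Proof.
rewrite /form; have -> : x *m M0 *m y^T = - (y *m M0 *m x^T)^T.
  by rewrite !trmx_mul trmxK M0T mulNmx mulmxN opprK mulmxA.
by rewrite [LHS]mxE; congr (- _); rewrite [LHS]mxE.
Qed.

(* [T] is self-adjoint for [M0]: this is how the skewness of [M1] enters. *)
Let formT x y : form (x *m T) y = form x (y *m T).
Proof.
by rewrite /form trmx_mul -[x *m T *m M0]mulmxA mulTM0 -mulM0T !mulmxA.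
Qed.

Let form_pow x y i j : form (pow x i) (pow y j) = form x (pow y (i + j)).
Proof.
elim: i j => [|i IHi] j //=.
by rewrite formT -[_ *m T]/(pow y j.+1) IHi addnS.
Qed.

(* The form being alternating, iterates of a single vector span an isotropic
   subspace. *)
Let form_self x i j : form (pow x i) (pow x j) = 0.
Proof. by apply: self_opp0; rewrite [LHS]formC !form_pow addnC. Qed.

(** The basis [u, u T, .., u T^(d-1), v, v T, .., v T^(d-1)], where [v] is dual to the
    iterates of [u].  By self-adjointness the pairing of [u T^i] with [v T^j] depends
    on [i + j] only, which gives the Hankel blocks, and the choice of [v] fixes the
    first [d] entries of the sequence. *)
Lemma hankel_normal_form (u : 'rV[k]_(2 * d)) : (0 < d)%N ->
  row_free (krylov u T) ->
  exists (P : 'M[k]_(2 * d)) (h : nat -> k),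
    [/\ P \in unitmx, forall m, (m < d)%N -> h m = (m.+1 == d)%:R,
        P *m M0 *m P^T = hankel d 0 h & P *m M1 *m P^T = hankel d 1 h].
Proof.
move=> d0 Kfree.
have [B KB] : exists B, krylov u T *m M0 *m B = 1%:M.
  by apply/row_freeP; rewrite /row_free mxrankMfree // row_free_unit.
have pd : (d.-1 < d)%N by rewrite prednK.
pose v : 'rV[k]_(2 * d) := (col (Ordinal pd) B)^T; pose h m := form u (pow v m).
have hd m : (m < d)%N -> h m = (m.+1 == d)%:R.
  move=> md; rewrite /h -[u]/(pow u 0) -(add0n m) addnC -form_pow.
  have -> : form (pow u m) (pow v 0) = (krylov u T *m M0 *m B) (Ordinal md) (Ordinal pd).
    rewrite /form trmxK [LHS]mxE [RHS]mxE; apply: eq_bigr => c _; congr (_ * _).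
      by rewrite !mxE; apply: eq_bigr => c' _; rewrite !mxE.
    by rewrite !mxE.
  by rewrite KB mxE -val_eqE /= addn0 -eqSS prednK.
pose P : 'M[k]_(2 * d) := \matrix_(a < 2 * d) (if (a < d)%N then pow u a else pow v (a - d)).
have PE N a b : (P *m N *m P^T) a b = (row a P *m N *m (row b P)^T) 0 0.
  by rewrite -row_mul !mxE; apply: eq_bigr => c _; rewrite !mxE.
have GE e a b : form (iter e (mulmx^~ T) (row a P)) (row b P) = hankel d e h a b.
  rewrite /P !rowK /hankel mxE.
  have powS w c : iter e (mulmx^~ T) (pow w c) = pow w (e + c) by rewrite /pow iterD.
  case: (ltnP a d) => ad; case: (ltnP b d) => bd /=; rewrite powS ?form_self //.
    by rewrite form_pow; congr (form _ (pow _ _)); lia.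
  by rewrite formC !form_pow; congr (- form _ (pow _ _)); lia.
have P0 : P *m M0 *m P^T = hankel d 0 h.
  by apply/matrixP => a b; rewrite PE -GE.
have P1 : P *m M1 *m P^T = hankel d 1 h.
  by apply/matrixP => a b; rewrite PE -GE /= /form -[_ *m T *m M0]mulmxA mulTM0.
exists P, h; split=> //.
(* [P] is invertible because the Hankel matrix [P *m M0 *m P^T] is. *)
by have := hankel_unit hd; rewrite -P0 !unitmx_mul => /andP[/andP[]].
Qed.

End NormalForm.

Section Nondegenerate.
Variables (k : fieldType) (d : nat).
Implicit Types M : 'M[k]_(2 * d).

Lemma nondeg_unit (M0 M1 : 'M[k]_(2 * d)) : nondeg M0 M1 != 0 -> M0 \in unitmx.
Proof. by rewrite mulf_eq0 negb_or unitmxE unitfE => /andP[]. Qed.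

Lemma nondeg_free (M0 M1 : 'M[k]_(2 * d)) : nondeg M0 M1 != 0 ->
  row_free (krylov (row0 k d) (M1 *m invmx M0)).
Proof.
move=> nd; have M0u := nondeg_unit nd; move: nd.
rewrite mulf_eq0 negb_or => /andP[D0]; set K' := krylov _ _ => K'0.
set K := krylov _ _.
(* The adjugate differs from the inverse by the factor [\det M0]. *)
have KK : K' = diag_mx (\row_i \det M0 ^+ i) *m K.
  have E i : iter i (mulmx^~ (M1 *m \adj M0)) (row0 k d) =
      \det M0 ^+ i *: iter i (mulmx^~ (M1 *m invmx M0)) (row0 k d).
    elim: i => [|j IHj] /=; first by rewrite scale1r.
    rewrite IHj -scalemxAl exprSr -scalerA; congr (_ *: _).
    rewrite scalemxAr; congr (_ *m _).
    by rewrite scalemxAr /invmx M0u scalerA mulfV // scale1r.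
  by apply/matrixP => i j; rewrite mul_diag_mx !mxE E mxE.
rewrite /row_free eqn_leq rank_leq_row /=.
have dr : (d <= \rank K')%N.
  have : colsub (widen_ord (widen_subproof d)) K' \in unitmx by rewrite unitmxE unitfE.
  move/mxrank_unit => {1}<-; rewrite -[K' in X in (X <= _)%N]mulmx1 -mulmx_colsub.
  exact: mxrankM_maxl.
by apply: leq_trans dr _; rewrite KK; apply: mxrankM_maxr.
Qed.

(** The pencil is the Hankel normal form with [h] zero beyond the fixed entries; there
    the Krylov vectors are basis vectors, up to scalars. *)
Lemma nondeg_example : exists M0 M1 : 'M[k]_(2 * d),
  [/\ M0^T = - M0, M1^T = - M1 & nondeg M0 M1 != 0].
Proof.
pose h m : k := (m.+1 == d)%:R.
have skew e : (hankel d e h)^T = - hankel d e h.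
  apply/matrixP => a b; rewrite !mxE (addnC a b).
  by case: (ltnP b d); case: (ltnP a d); rewrite ?oppr0 ?opprK.
exists (hankel d 0 h), (hankel d 1 h); split=> //.
set M0 := hankel d 0 h; set M1 := hankel d 1 h.
have M0u : M0 \in unitmx by apply: hankel_unit => m _.
have D0 : \det M0 != 0 by rewrite -unitfE -unitmxE.
pose e i : 'rV[k]_(2 * d) := \row_b (b == i :> nat)%:R.
have shift i : (i.+1 < d)%N -> e i *m M1 = e i.+1 *m M0.
  move=> id1; have i2 : (i.+1 < 2 * d)%N by lia.
  have eE j (jd : (j < 2 * d)%N) : e j = delta_mx 0 (Ordinal jd).
    by apply/rowP => b; rewrite !mxE -val_eqE.
  rewrite (eE _ i2) (eE _ (ltnW i2)) -!rowE; apply/rowP => b; rewrite !mxE /=.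
  rewrite [(d <= i)%N]leqNgt [(d <= i.+1)%N]leqNgt (ltnW id1) id1 !andbF /=.
  case: (leqP d b) => bd //=.
  by rewrite /h; congr (_ == _)%:R; lia.
have KE (i : nat) : (i < d)%N ->
    iter i (mulmx^~ (M1 *m \adj M0)) (row0 k d) = \det M0 ^+ i *: e i.
  elim: i => [|i IHi] id1; first by rewrite scale1r.
  rewrite iterS IHi ?(ltnW id1) // -scalemxAl mulmxA shift // -mulmxA mul_mx_adj.
  by rewrite mul_mx_scalar scalerA exprSr.
rewrite mulf_neq0 //.
have -> : colsub (widen_ord (widen_subproof d)) (krylov (row0 k d) (M1 *m \adj M0)) =
    diag_mx (\row_i \det M0 ^+ i).
  apply/matrixP => i j; rewrite !mxE KE // !mxE mulr_natr.
  by congr (_ *+ _); rewrite -val_eqE /= eq_sym.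
by rewrite det_diag; apply/prodf_neq0 => i _; rewrite mxE expf_neq0.
Qed.

End Nondegenerate.

(** * Counting parameters *)

Section NormalFamily.
Variables (k : fieldType) (d : nat).
Hypothesis char0 : [pchar k] =i pred0.

Definition normal_coef (R : comNzRingType) (h : nat -> R) (S : nat -> 'M[R]_(2 * d))
  (i : 'I_5) : 'M[R]_(2 * d) :=
  match val i with 0%N => hankel d 0 h | 1%N => hankel d 1 h | l.+2 => S l end.

Definition upper := {p : 'I_(2 * d) * 'I_(2 * d) | (p.1 < p.2)%N}.
(** The parameters of the family: a scalar factor of the Pfaffian, the free entries of
    the sequence [h], and three arbitrary skew matrices. *)
Definition param := (unit + 'I_d + 'I_3 * upper)%type.

Local Notation A := {mpoly k[#|{: param}|]}.
Let var (t : param) : A := 'X_(enum_rank t).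

Definition generic_h (m : nat) : A :=
  if (m < d)%N then (m.+1 == d)%:R
  else if insub (m - d)%N is Some r then var (inl (inr r)) else 0.

Definition generic_S (l : nat) : 'M[A]_(2 * d) :=
  \matrix_(a, b) if insub (a, b) is Some p then var (inr (inord l, p))
                 else if insub (b, a) is Some p then - var (inr (inord l, p)) else 0.

Definition generic_normal := linear_matrix (normal_coef generic_h generic_S).

Lemma generic_normalP c (h : nat -> k) (S : nat -> 'M[k]_(2 * d)) :
  (forall m, (m < d)%N -> h m = (m.+1 == d)%:R) -> (forall l, (S l)^T = - S l) ->
  exists2 x, (var (inl (inl tt))).@[x] = c &
    map_mx (map_mpoly (meval x)) generic_normal = linear_matrix (normal_coef h S).
Proof.
move=> hd St.
pose x (j : 'I_#|{: param}|) : k := match enum_val j with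
  | inl (inl _) => c | inl (inr r) => h (d + r)%N
  | inr (l, p) => S l (val p).1 (val p).2 end.
have xE t : (var t).@[x] = match t with
  | inl (inl _) => c | inl (inr r) => h (d + r)%N
  | inr (l, p) => S l (val p).1 (val p).2 end by rewrite mevalXU /x enum_rankK.
exists x; first by rewrite xE.
have hE m : (m < 2 * d)%N -> (generic_h m).@[x] = h m.
  rewrite /generic_h; case: (ltnP m d) => [md _|dm m2]; first by rewrite rmorph_nat hd.
  case: insubP => [r _ rm|/negP[]]; first by rewrite xE rm subnKC.
  by move: m2; lia.
have hankelE e : (e <= 1)%N -> map_mx (meval x) (hankel d e generic_h) = hankel d e h.
  move=> e1; apply/matrixP => a b; rewrite !mxE.
  have lt : (d <= a \/ d <= b)%N -> (a < d \/ b < d)%N -> (a + b - d + e < 2 * d)%N.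
    by have := ltn_ord a; have := ltn_ord b; lia.
  case: ifP => [/andP[ad db]|_]; first by apply: hE; apply: lt; [right | left].
  case: ifP => [/andP[bd da]|_]; last by rewrite meval0.
  by rewrite mevalN; congr (- _); apply: hE; apply: lt; [left | right].
have SE l : (l < 3)%N -> map_mx (meval x) (generic_S l) = S l.
  move=> l3; apply/matrixP => a b; rewrite !mxE.
  have Sab : S l a b = - S l b a by have /matrixP/(_ b a) := St l; rewrite !mxE.
  case: insubP => [p _ pE|]; first by rewrite xE pE inordK.
  rewrite -leqNgt /= => ba; case: insubP => [p _ pE|].
    by rewrite mevalN xE pE inordK.
  rewrite -leqNgt /= => ab; have ab' : a = b by apply/val_inj/anti_leq; rewrite ab ba.
  rewrite meval0; apply/esym/(@self_opp0 k); last by rewrite {1}Sab ab'.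
  by rewrite (pcharf0P k).1.
rewrite map_linear_matrix; apply: eq_bigr => i _; congr (_ *: map_mx _ _).
rewrite /normal_coef; case: i => -[|[|l]] li //=; try exact: hankelE.
exact: SE.
Qed.

Lemma card_param : #|{: param}| = (1 + d + 3 * 'C(2 * d, 2))%N.
Proof.
rewrite !card_sum card_unit card_prod !card_ord; congr (_ + _ * _)%N.
rewrite card_sig -sum1_card.
rewrite (eq_bigl (fun p : 'I_(2 * d) * 'I_(2 * d) => true && (p.1 < p.2)%N)) //.
rewrite -(pair_big_dep predT (fun a b : 'I_(2 * d) => (a < b)%N) (fun _ _ => 1%N)) /=.
rewrite (exchange_big_dep predT) //= -bin2_sum big_mkord; apply: eq_bigr => b _.
by rewrite (big_ord_narrow (ltnW (ltn_ord b))) sum1_card card_ord.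
Qed.

Lemma nformsE : nforms 5 d = 'C(d + 4, 4).
Proof.
have us : uniq (codom (@form_mon 5 d)).
  by rewrite map_inj_uniq ?enum_uniq //; apply: form_mon_inj.
have memE m : (m \in codom (@form_mon 5 d)) = (mdeg m == d).
  apply/codomP/eqP => [[i ->]|/form_mon_surj[i <-]]; last by exists i.
  exact: mdeg_form_mon.
have cd := size_codom (@form_mon 5 d); rewrite card_ord in cd; rewrite -cd.
rewrite -(bin_sub (leq_addl d 4)) addnK -(size_basis 4 d).
apply/perm_size/uniq_perm; rewrite ?uniq_basis // => m.
by rewrite memE basis_cover.
Qed.

(** For [d = 6] there are 205 parameters and 210 coefficients; the difference is a
    polynomial in [d - 6] with positive coefficients. *)
Lemma param_lt : (5 < d)%N -> (#|{: param}| < nforms 5 d)%N.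
Proof.
rewrite card_param nformsE => d5; have c2 : 'C(2 * d, 2) = (d * (2 * d).-1)%N.
  by rewrite bin2 -mulnA mul2n doubleK.
have := bin_ffact (d + 4) 4; rewrite c2 !ffactnS ffactn0 muln1 -(subnK d5).
have -> : 4`! = 24%N by [].
move: (d - 6)%N => e; move: (binomial _ _) => c.
have -> : (2 * (e + 6)).-1 = (2 * e + 11)%N by lia.
have -> : (e + 6 + 4).-1.-2 = (e + 7)%N by lia.
have -> : (e + 6 + 4).-2 = (e + 8)%N by lia.
have -> : (e + 6 + 4).-1 = (e + 9)%N by lia.
move=> c24; rewrite -(ltn_pmul2r (isT : 0 < 24)%N) c24.
have -> : ((e + 6 + 4) * ((e + 9) * ((e + 8) * (e + 7))))%N =
    ((1 + (e + 6) + 3 * ((e + 6) * (2 * e + 11))) * 24 +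
     (e * e * e * e + 34 * (e * e * e) + 287 * (e * e) + 734 * e + 120))%N by ring.
by rewrite -[X in (X < _)%N]addn0 ltn_add2l addn_gt0 orbT.
Qed.

(** More polynomials than variables: the coefficients of the Pfaffian satisfy a
    common algebraic relation on the whole family. *)
Lemma normal_family_closed : (5 < d)%N ->
  exists2 P : {mpoly k[nforms 5 d]}, P != 0 & forall c h S,
    (forall m, (m < d)%N -> h m = (m.+1 == d)%:R) -> (forall l, (S l)^T = - S l) ->
    P.@[fun i => c * (pfaffian (linear_matrix (normal_coef h S)))@_(form_mon i)] = 0.
Proof.
move=> d5; pose f := [tuple var (inl (inl tt)) * pf_coef generic_normal i | i < nforms 5 d].
have [P P0 Pf] := mpoly_dependent f (param_lt d5).
exists P => // c h S hd St; have [x xc xN] := generic_normalP c hd St.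
rewrite -(meval0 x) -Pf comp_mpoly_meval; apply: meval_eq => i.
by rewrite tnth_mktuple mevalM xc pf_coefP /specialize xN.
Qed.

End NormalFamily.

Section Closed.
Variables (k : fieldType) (d : nat).
Hypothesis char0 : [pchar k] =i pred0.
Hypothesis d0 : (0 < d)%N.

Let two_neq0 : 2%:R != 0 :> k.
Proof. by rewrite (pcharf0P k).1. Qed.

Let mpoly_char2 (p : {mpoly k[5]}) : p + p = 0 -> p = 0.
Proof.
move/eqP; rewrite -mulr2n -scaler_nat => /eqP p2.
by rewrite -[p](scalerK two_neq0) p2 scaler0.
Qed.

Variable P : {mpoly k[nforms 5 d]}.
Hypothesis Pnormal : forall c (h : nat -> k) (S : nat -> 'M[k]_(2 * d)),
    (forall m, (m < d)%N -> h m = (m.+1 == d)%:R) -> (forall l, (S l)^T = - S l) ->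
    P.@[fun i => c * (pfaffian (linear_matrix (normal_coef h S)))@_(form_mon i)] = 0.

Let i0 : 'I_5 := Ordinal (isT : 0 < 5)%N.
Let i1 : 'I_5 := Ordinal (isT : 1 < 5)%N.

Lemma vanish_nondeg c (C : 'I_5 -> 'M[k]_(2 * d)) : (forall i, (C i)^T = - C i) ->
  nondeg (C i0) (C i1) != 0 ->
  P.@[fun i => c * (pfaffian (linear_matrix C))@_(form_mon i)] = 0.
Proof.
move=> Ct nd; have M0u := nondeg_unit nd.
have [Q [h [Qu hd Q0 Q1]]] :=
  hankel_normal_form two_neq0 (Ct i0) (Ct i1) M0u d0 (nondeg_free nd).
pose S l := Q *m C (inord l.+2) *m Q^T.
have St l : (S l)^T = - S l.
  by rewrite /S !trmx_mul trmxK Ct mulNmx mulmxN mulmxA.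
have NE : linear_matrix (fun i => Q *m C i *m Q^T) = linear_matrix (normal_coef h S).
  apply: eq_bigr => i _; congr (_ *: map_mx _ _).
  rewrite /normal_coef; case: i => -[|[|l]] li /=.
  - by rewrite -Q0; congr (_ *m C _ *m _); apply: val_inj.
  - by rewrite -Q1; congr (_ *m C _ *m _); apply: val_inj.
  by rewrite /S; congr (_ *m C _ *m _); apply: val_inj; rewrite /= inordK.
have CE : linear_matrix C = map_mx (@mpolyC 5 k) (invmx Q) *m
    linear_matrix (normal_coef h S) *m (map_mx (@mpolyC 5 k) (invmx Q))^T.
  rewrite -NE linear_matrix_congr; apply: eq_bigr => i _; congr (_ *: map_mx _ _).
  by rewrite !mulmxA mulVmx // mul1mx -mulmxA -trmx_mul mulVmx // trmx1 mulmx1.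
have Nt : (linear_matrix (normal_coef h S))^T = - linear_matrix (normal_coef h S).
  rewrite -NE; apply: tr_linear_matrix => i.
  by rewrite !trmx_mul trmxK Ct mulNmx mulmxN mulmxA.
have [e pfE] := pfaffian_congr (@mpolyC 5 k : {rmorphism k -> {mpoly k[5]}})
  mpoly_char2 Nt (invmx Q).
rewrite -(Pnormal (c * e) hd St); apply: meval_eq => i.
by rewrite -mulrA CE pfE mcoeffCM.
Qed.

(** The line from [C] to a nondegenerate matrix meets the nondegenerate locus in a
    nonempty open subset, on which [P] vanishes; so [P] vanishes along the line. *)
Lemma vanish_skew_linear c (M : 'M[{mpoly k[5]}]_(2 * d)) : skew_linear M ->
  P.@[fun i => c * (pfaffian M)@_(form_mon i)] = 0.
Proof.
move=> /skew_linearP[C -> Ct].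
have [E0 [E1 [E0t E1t nd]]] := @nondeg_example k d.
pose D (i : 'I_5) := if i == i0 then E0 - C i else if i == i1 then E1 - C i else 0.
have Dt i : (D i)^T = - D i.
  by rewrite /D; do 2?case: ifP => _; rewrite ?linearB /= ?E0t ?E1t ?Ct ?opprD // trmx0 oppr0.
pose line t i := C i + t *: D i.
have lineT t i : (line t i)^T = - line t i.
  by rewrite /line linearD linearZ /= Ct Dt opprD scalerN.
pose pencil i := map_mx polyC (C i) + 'X *: map_mx polyC (D i).
have pencilE t i : map_mx (horner_eval t) (pencil i) = line t i.
  by apply/matrixP => a b; rewrite !mxE /horner_eval !hornerE.
pose delta := nondeg (pencil i0) (pencil i1).
have deltaE t : delta.[t] = nondeg (line t i0) (line t i1).
  by rewrite -!pencilE -(nondeg_map (horner_eval t)).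
have delta0 : delta != 0.
  apply: contra_neq nd => delta0; have := deltaE 1; rewrite delta0 horner0.
  have -> : line 1 i0 = E0 by rewrite /line scale1r /D eqxx addrC subrK.
  by have -> : line 1 i1 = E1 by rewrite /line scale1r /D /= addrC subrK.
pose Gam : {poly {mpoly k[5]}} :=
  pfaffian (map_mx polyC (linear_matrix C) + 'X *: map_mx polyC (linear_matrix D)).
have GamE t : Gam.[t%:MP] = pfaffian (linear_matrix (line t)).
  rewrite -[LHS]/(horner_eval _ _) pfaffian_map; congr pfaffian.
  have pE (X Y : 'M[{mpoly k[5]}]_(2 * d)) a b :
      (map_mx polyC X + 'X *: map_mx polyC Y) a b = (X a b)%:P + 'X * (Y a b)%:P.
    by rewrite !mxE.
  apply/matrixP => a b; rewrite mxE pE /= /horner_eval !hornerE !linear_matrixE.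
  rewrite mul_mpolyC scaler_sumr -big_split /=; apply: eq_bigr => i _.
  by rewrite !mxE scalerDl scalerA.
pose gam (i : 'I_(nforms 5 d)) : {poly k} := c *: map_poly (mcoeff (form_mon i)) Gam.
have gamE t i : (gam i).[t] = c * (pfaffian (linear_matrix (line t)))@_(form_mon i).
  by rewrite hornerZ horner_mcoeff GamE.
pose q : {poly k} := mmap polyC gam P.
have qE t : q.[t] = P.@[fun i => (gam i).[t]] by apply: horner_mmap.
have /eqP : delta * q = 0.
  apply: (poly_fun_eq0 char0) => t; rewrite hornerM qE.
  have [->|dt] := eqVneq delta.[t] 0; first by rewrite mul0r.
  rewrite (meval_eq (v2 := fun i => c * (pfaffian (linear_matrix (line t)))@_(form_mon i))) //.
  by rewrite vanish_nondeg ?mulr0 // -deltaE.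
rewrite mulf_eq0 (negPf delta0) /= => /eqP q0.
have := qE 0; rewrite q0 horner0 => /esym; rewrite -[X in _ = X -> _]/(0 : k) => <-.
apply: meval_eq => i; rewrite gamE; congr (_ * (pfaffian _)@__).
by apply: eq_bigr => j _; rewrite /line scale0r addr0.
Qed.

(** Where neither [P] nor the polynomials cutting out an open set of forms vanish,
    there is a form in this set that is not a linear Pfaffian. *)
Lemma not_general_of_closed : P != 0 ->
  ~ general_hypersurface (fun F : dhomog 5 k d => linear_pfaffian F).
Proof.
move=> P0 [U [[S [_ US]] [F0 UF0] UQ]].
have [_ [Q SQ QF0]] := (US F0).1 UF0.
have Q0 : Q != 0 by apply: contra_neq QF0 => ->; rewrite meval0.
pose i := Ordinal (nforms_gt0 d).
have X0 : 'X_i != 0 :> {mpoly k[nforms 5 d]} by rewrite -msize_poly_eq0 msizeX.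
have [y] := mpoly_nonroot char0 (mulf_neq0 (mulf_neq0 P0 Q0) X0).
rewrite !mevalM mevalXU !mulf_eq0 !negb_or -andbA => /and3P[Py Qy yi].
pose F := DHomog (form_of_homog y).
have Fy : form_coef F =1 y by move=> j; rewrite form_coefE mcoeff_form_of.
have /UQ[M [MT M1 [c c0 pfM]]] : U F.
  apply/US; split; first by rewrite -val_eqE /=; apply: form_of_neq0 yi.
  by exists Q => //; rewrite (meval_eq _ Fy).
case/eqP: Py; rewrite -[RHS](vanish_skew_linear c^-1 (conj MT M1)).
by apply: meval_eq => j; rewrite pfM mcoeffZ mulKf // -Fy.
Qed.

End Closed.

(** * General threefolds *)

Theorem proposition8p9 (k : closedFieldType) (d : nat)
    (char0 : [pchar k] =i pred0) (d_gt0 : (1 <= d)%N) :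
  general_hypersurface (fun F : dhomog 5 k d => linear_pfaffian F) <->
  (d <= 5)%N.
Proof.
split=> [gen|d5]; last first.
  have dd : d.-1 \in iota 0 5 by rewrite mem_iota /= add0n -ltnS prednK.
  have /andP[tab5] := allP tables_span _ dd; rewrite prednK //.
  exact: general_of_spans.
rewrite leqNgt; apply/negP => d6.
have [P P0 Pnormal] := normal_family_closed char0 d6.
exact: (not_general_of_closed char0 d_gt0 Pnormal P0 gen).
Qed.
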